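(* Consider the linear control system $\Sigma_{\mathbb{H}}$ on the Heisenberg group and assume that it satisfies the LARC and that the derivation $\mathcal{D}$ of its drift satisfies $\det A=0$ and $\operatorname{tr}A\neq0$. Then, up to conjugations (that is, after replacing $\Sigma_{\mathbb{H}}$ by the equivalent control-affine system $\Sigma_{\mathbb{R}^3}$ on $\mathbb{R}\times\mathbb{R}^2$ described in the context), the set $$\mathcal{C}_{\mathbb{H}}=\pi^{-1}\left(\mathcal{C}^A_{\mathbb{R}^2}\right)$$ is the unique control set of $\Sigma_{\mathbb{H}}$, where $\pi:\mathbb{R}\times\mathbb{R}^2\to\mathbb{R}^2$ is the canonical projection onto the last two components and $\mathcal{C}^A_{\mathbb{R}^2}$ is the control set of the associated system $\Sigma^A_{\mathbb{R}^2}$ defined in the context.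
   Context: The Heisenberg group is $\mathbb{H}=\mathbb{R}^2\times\mathbb{R}$ with product $(\mathbf{v}_1,z_1)*(\mathbf{v}_2,z_2)=(\mathbf{v}_1+\mathbf{v}_2,\,z_1+z_2+\frac12\omega(\mathbf{v}_1,\mathbf{v}_2))$, where $\omega(\mathbf{v}_1,\mathbf{v}_2)=\det(\mathbf{v}_1|\mathbf{v}_2)$. Its Lie algebra is $\mathfrak{h}=\mathbb{R}^2\times\mathbb{R}$ with $[(\zeta_1,\alpha_1),(\zeta_2,\alpha_2)]=(\mathbf{0},\omega(\zeta_1,\zeta_2))$. Let $\theta$ be the counter-clockwise rotation of $\mathbb{R}^2$ by $\pi/2$, so $\omega(\mathbf{v},\theta\eta)=\langle\mathbf{v},\eta\rangle$. For $A\in\mathfrak{gl}(2)$, $\eta\in\mathbb{R}^2$, let $\mathcal{D}=\begin{pmatrix}A&\mathbf{0}\\ \eta^{\top}&\operatorname{tr}A\end{pmatrix}$ (a derivation of $\mathfrak{h}$), and let $Z=(\zeta,\alpha)\in\mathfrak{h}$, with $\mathcal{D}\neq0$ and $\alpha^2+|\zeta|^2\neq0$. The (one-input) linear control system $\Sigma_{\mathbb{H}}$ is $$\dot{\mathbf{v}}=A\mathbf{v}+u\zeta,\qquad \dot z=z\operatorname{tr}A+u\alpha+\omega\left(\mathbf{v},\theta\eta+\tfrac{u}{2}\zeta\right),$$ where $u\in\Omega=[u_*,u^*]$, $u_*<0<u^*$. The set $\mathcal{U}$ of control functions consists of the piecewise constant functions with values in $\Omega$. $\Sigma_{\mathbb{H}}$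 satisfies the LARC (Lie algebra rank condition) if $\mathfrak{h}$ is the smallest $\mathcal{D}$-invariant Lie subalgebra containing $Z$. For a control system on $M$ with solutions $\varphi(\tau,x,\mathbf{u})$, let $\mathcal{O}^+(x)=\{\varphi(\tau,x,\mathbf{u}):\tau\ge0,\mathbf{u}\in\mathcal{U}\}$. A control set is a nonempty set $\mathcal{C}\subset M$ that is maximal (w.r.t. inclusion) with the properties: (i) for every $x\in\mathcal{C}$ there is $\mathbf{u}\in\mathcal{U}$ with $\varphi(\mathbb{R}^+,x,\mathbf{u})\subset\mathcal{C}$; (ii) $\mathcal{C}\subset\overline{\mathcal{O}^+(x)}$ for all $x\in\mathcal{C}$. Two control-affine systems are equivalent (conjugated) if a diffeomorphism of the state spaces carries the drift and control vector fields of one to those of the other; control sets are preserved by such a diffeomorphism. Normal form. Assume the LARC, $\det A=0$ and $\mu:=\operatorname{tr}A\neq0$. Conjugating by an automorphism $\begin{pmatrix}P&\mathbf{0}\\ \xi^{\top}&\det P\end{pmatrix}$ of $\mathbb{H}$ ($P\in GL(2)$, $\xi\in\mathbb{R}^2$), one may take $A=\operatorname{diag}(0,\mu)$ and $\alpha=0$; writing $\zeta=(\zeta_1,\zeta_2)$, $\eta=(\eta_1,\eta_2)$ for the resulting data, the LARC gives $\zeta_1\zeta_2\neq0$ and the system is $$\dot x=u\zeta_1,\quad \dot y=\mu y+u\zeta_2,\quad \dot z=\mu z+\tfrac u2(\zeta_1y-\zeta_2x)+\eta_1x+\eta_2y.$$ The diffeomorphism $f:\mathbb{H}\to\mathbb{R}^3$,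 $$f(x,y,z)=\left(\frac{\mu}{\zeta_1}x,\ \frac{\mu}{\zeta_2}y,\ \frac{\mu^2}{\zeta_1\zeta_2}\left(z+\tfrac12xy+\frac{\eta_1}{\mu\zeta_2}(\zeta_2x-\zeta_1y)\right)\right),$$ conjugates it to the control-affine system $$\Sigma_{\mathbb{R}^3}:\quad \dot x=\mu u,\quad \dot y=\mu(y+u),\quad \dot z=\mu(z+uy+\kappa y),\qquad \kappa:=\frac{\eta_2}{\zeta_1},\ u\in\Omega,$$ on $\mathbb{R}^3=\mathbb{R}\times\mathbb{R}^2\ni(x,(y,z))$. The associated system $\Sigma^A_{\mathbb{R}^2}$ is the system $\dot y=\mu(y+u)$, $\dot z=\mu(z+uy+\kappa y)$, $u\in\Omega$, on $\mathbb{R}^2$. Its equilibrium for the constant control $u$ is $\mathbf{w}(u)=(-u,u(u+\kappa))$. The set $\mathcal{C}^A_{\mathbb{R}^2}$ is the (well-defined, independent of $u$) control set of $\Sigma^A_{\mathbb{R}^2}$ that contains $\mathbf{w}(u)$ in its interior for every $u\in\operatorname{int}\Omega\setminus\{-\kappa\}$.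
   Formalization: If tr A > 0 and κ = 0, where further control sets with empty interior exist, uniqueness is claimed only among control sets with nonempty interior; the inversion (v,z)→(−v,−z), with ζ→−ζ, is inserted to correct the sign of the u/2 term in the normal form. *)

(* Defs.v *)
From mathcomp Require Import all_boot all_order all_algebra.
From mathcomp Require Import all_classical all_reals all_analysis.

Set Implicit Arguments.
Unset Strict Implicit.
Unset Printing Implicit Defensive.

Import Order.TTheory GRing.Theory Num.Theory.
Import numFieldNormedType.Exports.

Local Open Scope classical_set_scope.
Local Open Scope ring_scope.

Section ControlSystems.
Context {R : realType}.

Record control_affine (M : normedModType R) :=
  ControlAffine { drift : M -> M; control_field : M -> M }.

(* On every segment [a, b], [u] is constant between consecutive points of a
   finite list [s]; its values at the points of [s] are arbitrary. *)
Definition piecewise_constant (u : R -> R) : Prop :=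
  forall a b : R, exists s : seq R, forall t t' : R,
    a <= t -> t <= t' -> t' <= b ->
    (forall r, r \in s -> ~~ (t <= r <= t')) -> u t = u t'.

Definition control_function (lo hi : R) (u : R -> R) : Prop :=
  piecewise_constant u /\ forall t, lo <= u t <= hi.

(* [g t] is phi(t, g 0, u) for t >= 0: a continuous curve solving the equation
   away from the discontinuities of the control. *)
Definition trajectory (M : normedModType R) (S : control_affine M)
    (u : R -> R) (g : R -> M) : Prop :=
  {within `[0, +oo[, continuous g} /\
  forall t : R, 0 < t -> {for t, continuous u} ->
    is_derive t (1 : R) g (drift S (g t) + u t *: control_field S (g t)).

Definition positive_orbit (lo hi : R) (M : normedModType R)
    (S : control_affine M) (x : M) : set M :=
  [set y | exists (u : R -> R) (g : R -> M) (tau : R),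
    [/\ control_function lo hi u, trajectory S u g, g 0 = x,
        0 <= tau & g tau = y]].

Definition pre_control_set (lo hi : R) (M : normedModType R)
    (S : control_affine M) (C : set M) : Prop :=
  (forall x, C x -> exists (u : R -> R) (g : R -> M),
     [/\ control_function lo hi u, trajectory S u g, g 0 = x
       & forall t, 0 <= t -> C (g t)]) /\
  (forall x, C x -> C `<=` closure (positive_orbit lo hi S x)).

Definition control_set (lo hi : R) (M : normedModType R)
    (S : control_affine M) (C : set M) : Prop :=
  [/\ C !=set0, pre_control_set lo hi S C
    & forall C', pre_control_set lo hi S C' -> C `<=` C' -> C' = C].

Fixpoint is_Cn (n : nat) (V W : normedModType R) (f : V -> W) : Prop :=
  match n with
  | 0%N => continuous f
  | m.+1 => (forall x, differentiable f x) /\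
            (forall v, is_Cn m (fun x => 'd f x v))
  end.

Definition smooth (V W : normedModType R) (f : V -> W) : Prop :=
  forall n, is_Cn n f.

Definition diffeomorphism (V W : normedModType R) (f : V -> W) : Prop :=
  smooth f /\ exists g : W -> V, [/\ smooth g, cancel f g & cancel g f].

Definition conjugation (V W : normedModType R) (S : control_affine V)
    (T : control_affine W) (f : V -> W) : Prop :=
  [/\ diffeomorphism f,
      forall p, 'd f p (drift S p) = drift T (f p)
    & forall p, 'd f p (control_field S p) = control_field T (f p)].

End ControlSystems.

(* Carrier of both the Heisenberg group and its Lie algebra. *)
Notation heis R := ('cV[R]_2 * R)%type.

Section Heisenberg.
Context {R : realType}.

Local Notation heis := (heis R).

Definition omega (v w : 'cV[R]_2) : R := \det (row_mx v w : 'M[R]_2).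

Definition dotp (v w : 'cV[R]_2) : R := \sum_i v i 0 * w i 0.

Definition theta (v : 'cV[R]_2) : 'cV[R]_2 :=
  \col_i (if i == 0 then - v 1 0 else v 0 0).

Definition heis_mul (p q : heis) : heis :=
  (p.1 + q.1, p.2 + q.2 + 2^-1 * omega p.1 q.1).

Definition heis_inv (p : heis) : heis := (- p.1, - p.2).

Definition bracket (X Y : heis) : heis := (0, omega X.1 Y.1).

Definition derivation (A : 'M[R]_2) (eta : 'cV[R]_2) (X : heis) : heis :=
  (A *m X.1, dotp eta X.1 + \tr A * X.2).

Definition lie_subalgebra (L : set heis) : Prop :=
  [/\ L 0, forall X Y, L X -> L Y -> L (X + Y),
      forall (c : R) X, L X -> L (c *: X)
    & forall X Y, L X -> L Y -> L (bracket X Y)].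

Definition LARC (A : 'M[R]_2) (eta : 'cV[R]_2) (Z : heis) : Prop :=
  forall L : set heis, lie_subalgebra L ->
    (forall X, L X -> L (derivation A eta X)) -> L Z -> L = setT.

Definition heis_system (A : 'M[R]_2) (eta zeta : 'cV[R]_2) (alpha : R) :
    control_affine heis :=
  ControlAffine
    (fun p : heis => (A *m p.1, p.2 * \tr A + omega p.1 (theta eta)) : heis)
    (fun p : heis => (zeta, alpha + omega p.1 (2^-1 *: zeta)) : heis).

Definition heis_aut (P : 'M[R]_2) (xi : 'cV[R]_2) (p : heis) : heis :=
  (P *m p.1, dotp xi p.1 + \det P * p.2).

(* The automorphism (P, xi) carries (A, eta, (zeta, alpha)) to normal form, with
   resulting data (zeta', eta').  In the normal form
     x' = u zeta'_1,  y' = mu y + u zeta'_2,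
     z' = mu z + (u/2) (zeta'_1 y - zeta'_2 x) + eta'_1 x + eta'_2 y
   the bilinear term is omega (u/2 zeta') v, whereas [heis_system] has
   omega v (u/2 zeta).  The inversion (v, z) |-> (-v, -z) of the group exchanges
   the two orientations and changes zeta into - zeta, whence the sign of zeta'
   here and the [heis_inv] in [normalization]. *)
Definition normal_form_data (A : 'M[R]_2) (eta zeta : 'cV[R]_2) (alpha : R)
    (P : 'M[R]_2) (xi zeta' eta' : 'cV[R]_2) : Prop :=
  [/\ P \in unitmx,
      forall X, heis_aut P xi (derivation A eta X) =
        derivation (\tr A *: delta_mx 1 1) eta' (heis_aut P xi X)
    & heis_aut P xi (zeta, alpha) = (- zeta', 0)].

Definition heis_to_R3 (mu : R) (zeta eta : 'cV[R]_2) (p : heis) :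
    R * (R * R) :=
  let x := p.1 0 0 in let y := p.1 1 0 in let z := p.2 in
  let zeta1 := zeta 0 0 in let zeta2 := zeta 1 0 in let eta1 := eta 0 0 in
  (mu / zeta1 * x,
   (mu / zeta2 * y,
    mu ^+ 2 / (zeta1 * zeta2) *
      (z + 2^-1 * x * y
       + eta1 / (mu * zeta2) * (zeta2 * x - zeta1 * y)))).

Definition normalization (mu : R) (P : 'M[R]_2) (xi zeta' eta' : 'cV[R]_2)
    (p : heis) : R * (R * R) :=
  heis_to_R3 mu zeta' eta' (heis_inv (heis_aut P xi p)).

Definition R3_system (mu kappa : R) : control_affine (R * (R * R))%type :=
  ControlAffine
    (fun p => (0, (mu * p.2.1, mu * (p.2.2 + kappa * p.2.1))))
    (fun p => (mu, (mu, mu * p.2.1))).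

Definition R2_system (mu kappa : R) : control_affine (R * R)%type :=
  ControlAffine
    (fun q => (mu * q.1, mu * (q.2 + kappa * q.1)))
    (fun q => (mu, mu * q.1)).

Definition equilibrium (kappa u : R) : R * R := (- u, u * (u + kappa)).

Definition R2_control_set (lo hi mu kappa : R) (C : set (R * R)) : Prop :=
  control_set lo hi (R2_system mu kappa) C /\
  forall u, lo < u < hi -> u != - kappa -> interior C (equilibrium kappa u).

(* In this case the line y = z = 0 of equilibria for u = 0 does not meet the
   control set over [R2_control_set]: along every trajectory of [R3_system]
   q = z - y^2/2 satisfies q' = mu (q - y^2/2), so q <= 0 is forward invariant,
   while q = u^2/2 > 0 at [equilibrium 0 u].  The points (x, (0, 0)) then belong
   to further control sets, which have empty interior. *)
Definition degenerate (mu kappa : R) : Prop := 0 < mu /\ kappa = 0.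

End Heisenberg.

(* Main.v *)
From HB Require Import structures.
Require Import Defs.
From mathcomp Require Import all_boot all_order all_algebra ring lra.
From mathcomp Require Import all_classical all_reals all_analysis.

(** Why the theorem holds.

    Both systems have explicit flows for constant controls, and piecewise constant
    controls compose them, so the orbit of a point is the set of its images under
    finite schedules of constant controls ([positive_orbitP]).

    The planar control set consists of the points in two-way approximate
    communication with the equilibria of the controls u in the interior of the
    range, u <> - kappa ([core]).  These equilibria have neighbourhoods in which
    any point can be steered to any other ([local_controllability]), and they
    attract the whole plane in forward time if mu < 0, in backward time if mu > 0;
    hence they reach one another, and approximate reachability of one of them is
    exact reachability.

    In R^3 the coordinate x moves at constant speed mu u while the planar part
    rests at the equilibrium of u.  A planar path that visits equilibria of a
    positive and of a negative control is therefore completed to one with any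
    prescribed displacement of x ([core_steer]), which makes the preimage of the
    planar control set a control set ([core3_control_set]).

    Uniqueness rests on recurrence: a point of a set with the properties (i) and
    (ii) lies on arbitrarily long almost closed loops in R^3, and along those the
    displacement of x is almost 0 ([pre_control_set_return]).  If mu < 0,
    solutions with the same control approach each other, so an equilibrium that
    copies the loop comes back to the recurrent point
    ([pre_control_set_attracting]).  If mu > 0, put q = z - y ^ 2 / 2; then
    q' = mu (z - y ^ 2 + kappa y) for all controls, and the factor in parentheses
    vanishes exactly on the curve of equilibria.  A trajectory that avoids the
    control set cannot cross that curve, so q is monotone along it and does not
    recur.  The exceptional regions, where the curve of equilibria does not act as
    a barrier, have their own monotone functions; the only points that escape the
    argument have kappa = 0 and q = 0 ([pre_control_set_expanding]), and those
    contain no open set.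

    Finally a conjugation maps trajectories to trajectories in both directions,
    hence control sets to control sets ([control_set_preimage]).  For the
    normalization this requires a computation of its differential
    ([normalization_conjugation]); the rank condition enters as the
    nonvanishing of zeta' ([LARC_coord_neq0]). *)

Set Implicit Arguments.
Unset Strict Implicit.
Unset Printing Implicit Defensive.

Import Order.TTheory GRing.Theory Num.Theory.
Import numFieldNormedType.Exports.

Local Open Scope classical_set_scope.
Local Open Scope ring_scope.

(** * Curves and their derivatives *)
Section Curves.
Context {R : realType}.

Lemma is_deriveDf (V : normedModType R) (f g : V -> R) (x v : V) (df dg : R) :
  is_derive x v f df -> is_derive x v g dg ->
  is_derive x v (fun y => f y + g y) (df + dg).
Proof. exact: is_deriveD. Qed.

Lemma is_deriveNf (V : normedModType R) (f : V -> R) (x v : V) (df : R) :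
  is_derive x v f df -> is_derive x v (fun y => - f y) (- df).
Proof. exact: is_deriveN. Qed.

Lemma is_deriveMf (V : normedModType R) (f g : V -> R) (x v : V) (df dg : R) :
  is_derive x v f df -> is_derive x v g dg ->
  is_derive x v (fun y => f y * g y) (f x * dg + g x * df).
Proof. exact: is_deriveM. Qed.

Lemma is_derive_expRf (f : R -> R) (t df : R) :
  is_derive t 1 f df -> is_derive t 1 (fun s => expR (f s)) (expR (f t) * df).
Proof. by move=> h; exact: (is_derive1_comp (is_derive_expR (f t)) h). Qed.

Lemma is_derive_compd (V W : normedModType R) (F : V -> W) (g : R -> V)
    (t : R) (v : V) :
  differentiable F (g t) -> is_derive t 1 g v ->
  is_derive t 1 (F \o g) ('d F (g t) v).
Proof.
move=> dF [dg <-].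
have dg' : differentiable g t by exact/derivable1_diffP.
have dFg : differentiable (F \o g) t by exact: differentiable_comp.
split; first exact/derivable1_diffP.
by rewrite !deriveE// diff_comp.
Qed.

Lemma is_derive_pairf (V W : normedModType R) (f : R -> V) (g : R -> W)
    (t : R) (v : V) (w : W) :
  is_derive t 1 f v -> is_derive t 1 g w ->
  is_derive t 1 (fun s => (f s, g s)) (v, w).
Proof.
move=> [df <-] [dg <-].
have df' : differentiable f t by exact/derivable1_diffP.
have dg' : differentiable g t by exact/derivable1_diffP.
have dfg : differentiable (fun s => (f s, g s)) t by exact: differentiable_pair.
split; first exact/derivable1_diffP.
by rewrite !deriveE// diff_pair.
Qed.

Lemma is_diff_fst (V W : normedModType R) (p : V * W) : is_diff p fst fst.
Proof.
have h : continuous (fst : V * W -> V) by move=> q; exact: cvg_fst.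
apply: DiffDef.
  exact: (@linear_differentiable R _ _ (fst : {linear (V * W)%type -> V}) p h).
exact: (@diff_lin R _ _ (fst : {linear (V * W)%type -> V}) p h).
Qed.

Lemma is_diff_snd (V W : normedModType R) (p : V * W) : is_diff p snd snd.
Proof.
have h : continuous (snd : V * W -> W) by move=> q; exact: cvg_snd.
apply: DiffDef.
  exact: (@linear_differentiable R _ _ (snd : {linear (V * W)%type -> W}) p h).
exact: (@diff_lin R _ _ (snd : {linear (V * W)%type -> W}) p h).
Qed.

Lemma is_derive_fstf (V W : normedModType R) (g : R -> V * W) (t : R) v :
  is_derive t 1 g v -> is_derive t 1 (fun s => (g s).1) v.1.
Proof.
move=> h; have [d e] := is_diff_fst (g t).
by have := is_derive_compd d h; rewrite e.
Qed.

Lemma is_derive_sndf (V W : normedModType R) (g : R -> V * W) (t : R) v :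
  is_derive t 1 g v -> is_derive t 1 (fun s => (g s).2) v.2.
Proof.
move=> h; have [d e] := is_diff_snd (g t).
by have := is_derive_compd d h; rewrite e.
Qed.

Lemma within_comp (T U V : topologicalType) (A : set T) (h : T -> U)
    (f : U -> V) :
  {within A, continuous h} -> continuous f -> {within A, continuous (f \o h)}.
Proof.
move=> /subspace_continuousP hc fc; apply/subspace_continuousP => x Ax.
by apply: cvg_comp; [exact: hc | exact: fc].
Qed.

Lemma cvg_pairf (I : Type) (T U : topologicalType) (F : set_system I)
    {FF : Filter F} (f : I -> T) (g : I -> U) (a : T) (b : U) :
  f @ F --> a -> g @ F --> b -> (fun x => (f x, g x)) @ F --> (a, b).
Proof. by move=> fa gb; exact: (cvg_pair fa gb). Qed.

Lemma continuous_pairf (T U V : topologicalType) (f : T -> U) (g : T -> V) :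
  continuous f -> continuous g -> continuous (fun x => (f x, g x)).
Proof. by move=> hf hg x; exact: (cvg_pair (hf x) (hg x)). Qed.

Lemma continuous_into (T U V : topologicalType) (A : set U) (h : T -> U)
    (f : U -> V) :
  {within A, continuous f} -> continuous h -> (forall x, A (h x)) ->
  continuous (f \o h).
Proof.
move=> /subspace_continuousP fc hc hA x.
apply: (@cvg_comp _ _ _ h f _ (within A (nbhs (h x)))); last exact: (fc _ (hA x)).
move=> B /hc; rewrite /= /within => nB.
near=> y.
have /(_ (hA y)) // : A (h y) -> B (h y) by near: y.
Unshelve. all: by end_near. Qed.

Lemma derive0_eq (f : R -> R) (a b : R) : a <= b ->
  {within `[a, b], continuous f} ->
  (forall t, a < t < b -> is_derive t 1 f 0) -> f b = f a.
Proof.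
rewrite le_eqVlt => /predU1P[->//|ab] fc df.
have df' x : x \in `]a, b[ -> is_derive x 1 f 0 by rewrite in_itv/= => /df.
have [c _] := MVT ab df' fc.
by rewrite mul0r => /eqP; rewrite subr_eq0 => /eqP.
Qed.

Lemma derive_le0_le (f df : R -> R) (t : R) : 0 <= t ->
  (forall s : R, is_derive s 1 f (df s)) ->
  (forall s, 0 <= s <= t -> df s <= 0) -> f t <= f 0.
Proof.
move=> t0 hf hdf.
have fc : continuous f.
  by move=> s; apply: differentiable_continuous; apply/derivable1_diffP; case: (hf s).
have [c + e] := MVT_segment t0 (fun x _ => hf x) (continuous_subspaceT fc).
rewrite in_itv/= => hc.
by rewrite -subr_le0 e subr0 mulr_le0_ge0 // hdf.
Qed.

Lemma derive_gt0_lt (f df : R -> R) (t : R) : 0 < t ->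
  (forall s : R, is_derive s 1 f (df s)) ->
  (forall s, 0 <= s <= t -> 0 < df s) -> f 0 < f t.
Proof.
move=> t0 hf hdf.
have fc : continuous f.
  by move=> s; apply: differentiable_continuous; apply/derivable1_diffP; case: (hf s).
have [c + e] := MVT t0 (fun x _ => hf x) (continuous_subspaceT fc).
rewrite in_itv/= => /andP[c0 ct].
by rewrite -subr_gt0 e subr0 mulr_gt0 // hdf // !ltW.
Qed.

End Curves.

(** * Schedules: finite lists of constant controls *)

(** A schedule is a list of pairs (control value, length of time). *)
Definition admissible {R : realType} (lo hi : R) (s : seq (R * R)) : bool :=
  all (fun ct => (lo <= ct.1 <= hi) && (0 <= ct.2)) s.

Definition duration {R : realType} (s : seq (R * R)) : R := \sum_(ct <- s) ct.2.

Definition run {R : realType} {M : Type} (phi : R -> R -> M -> M)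
    (s : seq (R * R)) (x : M) : M :=
  foldl (fun y ct => phi ct.1 ct.2 y) x s.

(** An explicit solution operator [phi c t] for the constant control c, which is
    the only one on closed intervals.  The differential equation is asked for in
    the open interval only, as a trajectory need not be differentiable at the
    switching times of its control. *)
Definition has_flow {R : realType} {M : normedModType R} (S : control_affine M)
    (phi : R -> R -> M -> M) : Prop :=
  [/\ forall c x, phi c 0 x = x,
      forall c t, continuous (phi c t),
      forall c x (t : R), is_derive t (1 : R) (fun s => phi c s x)
        (drift S (phi c t x) + c *: control_field S (phi c t x))
    & forall c (g : R -> M) a b, a <= b -> {within `[a, b], continuous g} ->
        (forall t : R, a < t < b ->
          is_derive t (1 : R) g (drift S (g t) + c *: control_field S (g t))) ->
        g b = phi c (b - a) (g a)].

Section Schedules.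
Context {R : realType} {M : normedModType R}.
Implicit Types (s : seq (R * R)) (x y : M) (u : R -> R) (g : R -> M).

Lemma admissible_cat (lo hi : R) s1 s2 :
  admissible lo hi (s1 ++ s2) = admissible lo hi s1 && admissible lo hi s2.
Proof. exact: all_cat. Qed.

Lemma duration_cat s1 s2 : duration (s1 ++ s2) = duration s1 + duration s2.
Proof. exact: big_cat. Qed.

Lemma duration_cons (ct : R * R) s : duration (ct :: s) = ct.2 + duration s.
Proof. exact: big_cons. Qed.

Lemma duration_nil : duration [::] = 0 :> R.
Proof. exact: big_nil. Qed.

Lemma duration_ge0 (lo hi : R) s : admissible lo hi s -> 0 <= duration s.
Proof.
elim: s => [_|[c t] s IH]; first by rewrite duration_nil.
by rewrite duration_cons => /=/andP[/andP[_ t0] /IH]; exact: addr_ge0.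
Qed.

Lemma run_cat (T : Type) (phi : R -> R -> T -> T) s1 s2 (x : T) :
  run phi (s1 ++ s2) x = run phi s2 (run phi s1 x).
Proof. exact: foldl_cat. Qed.

Lemma is_derive_shiftf g (t a : R) v :
  is_derive (t - a) (1 : R) g v -> is_derive t (1 : R) (fun r => g (r - a)) v.
Proof.
move=> [dg <-].
have dg' : differentiable g (t - a) by exact/derivable1_diffP.
have h : is_derive t (1 : R) (fun r : R => r - a) 1.
  rewrite -[X in is_derive _ _ _ X]addr0.
  exact: (is_deriveDf (is_derive_id t 1) (is_derive_cst (- a) t 1)).
have h2 := @is_derive_compd R R^o M g (fun r : R => r - a) t 1 dg' h.
by rewrite deriveE.
Qed.

Variables (lo hi : R) (S : control_affine M) (phi : R -> R -> M -> M).
Hypothesis flow : has_flow S phi.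

Lemma run_continuous s : continuous (run phi s).
Proof.
have [_ fc _ _] := flow.
elim: s => [|[c t] s IH] x; first exact: cvg_id.
by apply: (@continuous_comp _ _ _ (phi c t) (run phi s) x); [exact: fc|exact: IH].
Qed.

(** The exceptional points of a piecewise constant control cut the interval into
    pieces on which uniqueness identifies the trajectory with the flow.
    Induction on the number of exceptional points inside the interval. *)
Lemma trajectory_run_piece u g (L : seq R) (a b : R) :
  control_function lo hi u -> trajectory S u g -> 0 <= a -> a <= b ->
  (forall t t', a <= t -> t <= t' -> t' <= b ->
    (forall r, r \in L -> ~~ (t <= r <= t')) -> u t = u t') ->
  exists s, [/\ admissible lo hi s, duration s = b - a
              & run phi s (g a) = g b].
Proof.
move=> [_ ub] [gc gd].
have [n] := ubnP (size [seq r <- L | a < r < b]).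
elim: n a b => // n IH a b; rewrite ltnS => szn a0 ab hL.
move: (ab); rewrite le_eqVlt => /predU1P[ab'|ab'].
  by exists [::]; rewrite duration_nil ab' subrr; split.
have [/hasP[r rL rab]|/hasPn noL] := boolP (has (fun r => a < r < b) L).
  have /andP[ar rb] := rab.
  have [||||s1 [A1 D1 R1]] := IH a r.
  - apply: leq_trans szn; rewrite !size_filter.
    rewrite -addn1.
    have -> : count (fun r0 : R => (a < r0 < b)%R) L =
        (count (fun r0 : R => (a < r0 < r)%R) L + count (fun r0 : R => (r <= r0 < b)%R) L)%N.
      elim: (L) => //= z l ->; rewrite addnACA; congr (_ + _)%N.
      by case: (ltP a z) => ?; case: (ltP z r) => ?; case: (ltP z b) => ? //=; exfalso; lra.
    rewrite leq_add2l -has_count; apply/hasP; exists r => //.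
    by rewrite lexx.
  - by [].
  - exact: ltW.
  - by move=> t t' h1 h2 h3; apply: hL => //; exact: le_trans h3 (ltW rb).
  have [||||s2 [A2 D2 R2]] := IH r b.
  - apply: leq_trans szn; rewrite !size_filter.
    rewrite -addn1.
    have -> : count (fun r0 : R => (a < r0 < b)%R) L =
        (count (fun r0 : R => (r < r0 < b)%R) L + count (fun r0 : R => (a < r0 <= r)%R) L)%N.
      elim: (L) => //= z l ->; rewrite addnACA; congr (_ + _)%N.
      by case: (ltP a z) => ?; case: (ltP r z) => ?; case: (ltP z b) => ? //=; exfalso; lra.
    rewrite leq_add2l -has_count; apply/hasP; exists r => //.
    by rewrite lexx ar.
  - exact: le_trans (ltW ar).
  - exact: ltW.
  - by move=> t t' h1 h2 h3; apply: hL => //; exact: le_trans (ltW ar) h1.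
  exists (s1 ++ s2); rewrite admissible_cat A1 A2 duration_cat D1 D2 run_cat R1 R2.
  by split => //; lra.
pose c := u ((a + b) / 2).
exists [:: (c, b - a)]; split.
- by rewrite /= ub/= subr_ge0 ab.
- by rewrite duration_cons duration_nil addr0.
have uc t : a < t < b -> u t = c.
  move=> /andP[at_ tb].
  have [h|h] := leP t ((a + b) / 2).
    apply: hL; [lra|lra|lra|move=> r /noL].
    by apply: contra => /andP[? ?]; lra.
  apply/esym/hL; [lra|lra|lra|move=> r /noL].
  by apply: contra => /andP[? ?]; lra.
have [_ _ _ uniq] := flow.
apply/esym/uniq => //.
  apply: continuous_subspaceW gc => t /=.
  by rewrite !in_itv/= andbT => /andP[/(le_trans a0)].
move=> t tab; rewrite -(uc t) //; apply: gd; first by lra.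
have nt : \forall r \near t, u r = u t.
  near=> r; rewrite !uc //; near: r.
  have : t \in `]a, b[ by rewrite in_itv.
  move=> /near_in_itvoo; apply: filterS => r; by rewrite in_itv.
exact: near_cst_continuous nt.
Unshelve. all: by end_near. Qed.

Lemma trajectory_run u g (tau : R) :
  control_function lo hi u -> trajectory S u g -> 0 <= tau ->
  exists s, [/\ admissible lo hi s, duration s = tau
              & run phi s (g 0) = g tau].
Proof.
move=> cu tg tau0; have [pc _] := cu.
have [L hL] := pc 0 tau.
by have [s] := trajectory_run_piece cu tg (lexx 0) tau0 hL; rewrite subr0; exists s.
Qed.

Let extend g (r : R) := g (Num.max 0 r).

Lemma extend_continuous g :
  {within `[0, +oo[, continuous g} -> continuous (extend g).
Proof.
move=> gc; have -> : extend g = g \o Num.max 0 by [].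
apply: (continuous_into gc).
  by move=> x; apply: (@continuous_max _ _ (fun=> 0) id x); [exact: cvg_cst|exact: cvg_id].
by move=> r; rewrite /= in_itv/= andbT le_max lexx.
Qed.

Lemma trajectory_const c x : trajectory S (fun=> c) (fun r => phi c r x).
Proof.
have [_ _ fd _] := flow; split; last by move=> t _ _; exact: fd.
apply: continuous_subspaceT => t.
by apply: differentiable_continuous; apply/derivable1_diffP; case: (fd c x t).
Qed.

Lemma control_function_const c : lo <= c <= hi -> control_function lo hi (fun=> c).
Proof. by move=> hc; split => // a b; exists [::]. Qed.

Section Concatenation.
Variables (c1 t1 : R) (u : R -> R) (g : R -> M) (x : M).
Hypotheses (lohi : lo < hi) (hc1 : lo <= c1 <= hi) (t1_ge0 : 0 <= t1).
Hypotheses (hu : control_function lo hi u) (hg : trajectory S u g).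
Hypothesis (g0 : g 0 = phi c1 t1 x).

(** The value at the switching time t1 differs from the value c1 just before it,
    so the concatenated control is discontinuous there whatever [u] is, and the
    equation is not required of the corner of [concat_curve]. *)
Definition concat_control (t : R) : R :=
  if t < t1 then c1 else if t == t1 then (if c1 == lo then hi else lo)
  else u (t - t1).

(** This formula avoids a case distinction: continuity at t1 is that of a sum of
    continuous functions. *)
Definition concat_curve (t : R) : M :=
  phi c1 (Num.min t t1) x + extend g (t - t1) - g 0.

Lemma concat_curve_le t : t <= t1 -> concat_curve t = phi c1 t x.
Proof.
move=> h; rewrite /concat_curve /extend min_l// max_l ?subr_le0//.
by rewrite addrK.
Qed.

Lemma concat_curve_ge t : t1 <= t -> concat_curve t = g (t - t1).
Proof.
move=> h; rewrite /concat_curve /extend min_r// max_r ?subr_ge0//.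
by rewrite -g0 addrC addKr.
Qed.

Lemma concat_control_function : control_function lo hi concat_control.
Proof.
have [pc ub] := hu; split; last first.
  move=> t; rewrite /concat_control; case: ltP => // _; case: eqP => // _.
  by case: ifP => _; rewrite lexx ltW.
move=> a b; have [L hL] := pc (a - t1) (b - t1).
exists (t1 :: [seq r + t1 | r <- L]) => t t' at_ tt' tb hr.
have := hr t1; rewrite inE eqxx => /(_ isT).
rewrite negb_and -!ltNge => /orP[h|h]; last first.
  by rewrite /concat_control h (le_lt_trans tt' h).
have h' := lt_le_trans h tt'.
rewrite /concat_control !ltNge (ltW h) (ltW h') /= !gt_eqF//.
apply: hL; [lra|lra|lra|move=> r rL].
have := hr (r + t1); rewrite inE (map_f (fun r => r + t1)) ?orbT// => /(_ isT).
by apply: contra => /andP[? ?]; lra.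
Qed.

Lemma concat_trajectory : trajectory S concat_control concat_curve.
Proof.
have [gc gd] := hg; have [_ _ fd _] := flow.
split.
  apply: continuous_subspaceT => t.
  apply: cvgB; last exact: cvg_cst.
  apply: cvgD.
    apply: (@continuous_comp _ _ _ (fun r => Num.min r t1) (fun r => phi c1 r x)).
      by apply: (@continuous_min _ _ id (fun=> t1) t); [exact: cvg_id|exact: cvg_cst].
    by apply: differentiable_continuous; apply/derivable1_diffP; case: (fd c1 x (Num.min t t1)).
  apply: (@continuous_comp _ _ _ (fun r => r - t1) (extend g)).
    by apply: cvgB; [exact: cvg_id|exact: cvg_cst].
  exact: extend_continuous.
move=> t t0 cu.
have [tt1|tt1|tt1] := ltgtP t t1.
- apply: (@near_eq_is_derive _ _ _ (fun r => phi c1 r x)).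
    near=> r; rewrite concat_curve_le//; apply: ltW; near: r.
    exact: lt_nbhsl.
  by rewrite concat_curve_le ?ltW// /concat_control tt1; exact: fd.
- apply: (@near_eq_is_derive _ _ _ (fun r => g (r - t1))).
    near=> r; rewrite concat_curve_ge//; apply: ltW; near: r.
    exact: lt_nbhsr.
  apply: is_derive_shiftf.
  rewrite concat_curve_ge ?ltW// /concat_control ltNge (ltW tt1)/= gt_eqF//.
  apply: gd; first by lra.
  have e : \forall r \near t, concat_control r = u (r - t1).
    near=> r; rewrite /concat_control.
    have h : t1 < r by near: r; exact: lt_nbhsr.
    by rewrite ltNge (ltW h)/= gt_eqF.
  have cu2 : {for t, continuous (fun r => u (r - t1))}.
    rewrite /prop_for /continuous_at -(nbhs_singleton e).
    by apply: cvg_trans cu; apply: near_eq_cvg; apply: filterS e => r ->.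
  have -> : u = (fun r => u (r - t1)) \o (fun r => r + t1).
    by apply/funext => r /=; rewrite addrK.
  apply: (@continuous_comp _ _ _ (fun r => r + t1) (fun r => u (r - t1))).
    by apply: cvgD; [exact: cvg_id|exact: cvg_cst].
  by rewrite /= subrK.
- exfalso; move: cu; rewrite tt1.
  set d := concat_control t1 => cu.
  have dc : d != c1.
    rewrite /d /concat_control ltxx eqxx; case: (altP (c1 =P lo)) => [->|].
      by rewrite gt_eqF.
    by rewrite eq_sym.
  have /cu : nbhs d [set v | v != c1].
    by apply: open_nbhs_nbhs; split => //; exact: open_neq.
  move=> /nbhs_ballP[e /= e0] /(_ (t1 - e / 2)).
  have he : 0 < e / 2 by rewrite divr_gt0.
  have hb : ball t1 e (t1 - e / 2).
    by rewrite /ball/= opprB addrC subrK gtr0_norm// ltr_pdivrMr// ltr_pMr// ltr1n.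
  by move=> /(_ hb) /=; rewrite /concat_control ifT ?eqxx// ltrBlDr ltrDl.
Unshelve. all: by end_near. Qed.

End Concatenation.

(** The alternative in the last clause is the form in which property (i) of
    control sets is verified below: up to the end of the schedule the curve stays
    between x and the target, and afterwards it follows the constant control c,
    under which the targets chosen below do not leave the set. *)
Lemma run_trajectory (c : R) s x :
  lo < hi -> lo <= c <= hi -> admissible lo hi s ->
  exists u g, [/\ control_function lo hi u, trajectory S u g, g 0 = x,
    g (duration s) = run phi s x &
    forall t, 0 <= t ->
      (exists s1 s2, [/\ admissible lo hi s1, admissible lo hi s2,
        run phi s1 x = g t & run phi s2 (g t) = run phi s x]) \/
      exists2 r, 0 <= r & g t = phi c r (run phi s x)].
Proof.
move=> lohi hc; have [f0 _ _ _] := flow.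
elim: s x => [|[c1 t1] s IH] x.
  move=> _; exists (fun=> c), (fun r => phi c r x); rewrite f0; split => //.
  - exact: control_function_const.
  - exact: trajectory_const.
  - by rewrite duration_nil f0.
  - by move=> t t0; right; exists t.
move=> /= /andP[/andP[hc1 ht1] As].
have [u [g [cu tg g0 gd h]]] := IH (phi c1 t1 x) As.
exists (concat_control c1 t1 u), (concat_curve c1 t1 g x); split.
- exact: concat_control_function.
- exact: concat_trajectory.
- by rewrite concat_curve_le// f0.
- rewrite duration_cons /= concat_curve_ge// ?lerDl ?(duration_ge0 As)//.
  by rewrite addrC addKr.
- move=> t t0; have [tt1|/ltW tt1] := leP t t1.
    left; exists [:: (c1, t)], ((c1, t1 - t) :: s).
    rewrite /= hc1 t0 As subr_ge0 tt1 concat_curve_le//; split => //.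
    congr (run phi s _).
    have [_ _ fd uniq] := flow.
    apply/esym/(uniq c1 (fun r => phi c1 r x) t t1) => //.
    apply: continuous_subspaceT => r.
    by apply: differentiable_continuous; apply/derivable1_diffP; case: (fd c1 x r).
  rewrite concat_curve_ge//.
  have [|[s1 [s2 [A1 A2 R1 R2]]]|] := h (t - t1); first by rewrite subr_ge0.
    by left; exists ((c1, t1) :: s1), s2; rewrite /= hc1 ht1 A1; split.
  by move=> [r r0 ->]; right; exists r.
Qed.

Lemma positive_orbitP (x y : M) : lo < hi ->
  positive_orbit lo hi S x y <-> exists2 s, admissible lo hi s & run phi s x = y.
Proof.
move=> lohi; split.
  move=> [u [g [tau [cu tg g0 tau0 gy]]]].
  by have [s [A _ R1]] := trajectory_run cu tg tau0; exists s; rewrite // -g0 R1.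
move=> [s As Ry].
have hlo : lo <= lo <= hi by rewrite lexx ltW.
have [u [g [cu tg g0 gd _]]] := run_trajectory x lohi hlo As.
by exists u, g, (duration s); rewrite gd Ry (duration_ge0 As); split.
Qed.

Definition reaches (x : M) : set M :=
  [set y | exists2 s, admissible lo hi s & run phi s x = y].

Lemma positive_orbitE x : lo < hi -> positive_orbit lo hi S x = reaches x.
Proof. by move=> lohi; apply/seteqP; split => y /(positive_orbitP _ _ lohi). Qed.

Lemma reaches_trans x y z : reaches x y -> reaches y z -> reaches x z.
Proof.
move=> [s1 A1 <-] [s2 A2 <-]; exists (s1 ++ s2); last by rewrite run_cat.
by rewrite admissible_cat A1.
Qed.

Lemma reaches_step c t x : lo <= c <= hi -> 0 <= t -> reaches x (phi c t x).
Proof. by move=> hc t0; exists [:: (c, t)] => //=; rewrite hc t0. Qed.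

(** Orbit closures compose, because the endpoint of a schedule depends
    continuously on its starting point. *)
Lemma closure_reaches_trans x y z :
  closure (reaches x) y -> closure (reaches y) z -> closure (reaches x) z.
Proof.
move=> xy yz B /nbhs_interior/yz[z' [[s As sz'] Bz']].
have /xy[y' [[s1 As1 sy'] By']] : nbhs y (run phi s @^-1` B).
  by rewrite -sz' in Bz'; exact: (run_continuous Bz').
exists (run phi s y'); split => //; exists (s1 ++ s).
  by rewrite admissible_cat As1.
by rewrite run_cat sy'.
Qed.

Lemma closure_reaches_shift x y z :
  reaches x y -> closure (reaches y) z -> closure (reaches x) z.
Proof. by move=> /subset_closure; exact: closure_reaches_trans. Qed.

Lemma pre_control_set_run (C : set M) x (T : R) :
  pre_control_set lo hi S C -> C x -> 0 <= T ->
  exists s, [/\ admissible lo hi s, duration s = T & C (run phi s x)].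
Proof.
move=> [C1 _] /C1[u [g [cu tg g0 Cg]]] T0.
have [s [As ds sx]] := trajectory_run cu tg T0.
by exists s; rewrite -g0 sx; split => //; exact: Cg.
Qed.

(** Recurrence: follow the set for time T by property (i), then come back close
    to x by property (ii).  The uniqueness of the control set rests on what such
    long almost closed loops exclude. *)
Lemma pre_control_set_return (C : set M) x (T : R) (B : set M) : lo < hi ->
  pre_control_set lo hi S C -> C x -> 0 <= T -> nbhs x B ->
  exists s, [/\ admissible lo hi s, T <= duration s & B (run phi s x)].
Proof.
move=> lohi pC Cx T0 nB; have [s [As ds Cs]] := pre_control_set_run pC Cx T0.
have [_ /(_ _ Cs _ Cx)] := pC; rewrite positive_orbitE// => /(_ _ nB).
move=> [y [[s' As' sy] By]]; exists (s ++ s'); split.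
- by rewrite admissible_cat As.
- by rewrite duration_cat ds lerDl (duration_ge0 As').
- by rewrite run_cat sy.
Qed.

End Schedules.

(** * Explicit flows of the planar and the spatial system *)
Section Flows.
Context {R : realType}.
Variables (mu kappa : R).

Definition R2_flow (c t : R) (q : R * R) : R * R :=
  (expR (mu * t) * (q.1 + c) - c,
   expR (mu * t) * q.2 +
     (c + kappa) * ((q.1 + c) * (mu * t) * expR (mu * t) -
                    c * (expR (mu * t) - 1))).

Definition R3_flow (c t : R) (p : R * (R * R)) : R * (R * R) :=
  (p.1 + mu * c * t, R2_flow c t p.2).

Lemma is_derive_mulr (k t : R) : is_derive t (1 : R) (fun s : R => k * s) k.
Proof.
have := is_deriveMf (is_derive_cst k t (1 : R)) (is_derive_id t (1 : R)).
by rewrite /= mulr1 mulr0 addr0.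
Qed.

Lemma is_derive_cstf (v t : R) :
  is_derive t (1 : R) (fun=> v) (0 : R).
Proof. exact: is_derive_cst. Qed.

Lemma is_derive_expM (k t : R) :
  is_derive t (1 : R) (fun s : R => expR (k * s)) (k * expR (k * t)).
Proof. by rewrite mulrC; exact: is_derive_expRf (is_derive_mulr k t). Qed.

Lemma R2_flow_derive c (q : R * R) (t : R) :
  is_derive t (1 : R) (fun s => R2_flow c s q)
    (drift (R2_system mu kappa) (R2_flow c t q) +
     c *: control_field (R2_system mu kappa) (R2_flow c t q)).
Proof.
have dE := is_derive_expM mu t.
have dy := is_deriveDf (is_deriveMf dE (is_derive_cstf (q.1 + c) t))
                       (is_derive_cstf (- c) t).
have dyt := is_deriveMf (is_derive_cstf (q.1 + c) t) (is_derive_mulr mu t).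
have dE1 := is_deriveDf dE (is_derive_cstf (- 1) t).
have dw := is_deriveDf (is_deriveMf dyt dE)
  (is_deriveNf (is_deriveMf (is_derive_cstf c t) dE1)).
have dz := is_deriveDf (is_deriveMf dE (is_derive_cstf q.2 t))
  (is_deriveMf (is_derive_cstf (c + kappa) t) dw).
refine (is_derive_eq (is_derive_pairf dy dz) _).
rewrite /= /R2_flow /=; congr pair; rewrite /= /GRing.scale /=; ring.
Qed.

Lemma R3_flow_derive c (p : R * (R * R)) (t : R) :
  is_derive t (1 : R) (fun s => R3_flow c s p)
    (drift (R3_system mu kappa) (R3_flow c t p) +
     c *: control_field (R3_system mu kappa) (R3_flow c t p)).
Proof.
have dx := is_deriveDf (is_derive_cstf p.1 t) (is_derive_mulr (mu * c) t).
refine (is_derive_eq (is_derive_pairf dx (R2_flow_derive c p.2 t)) _).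
rewrite /R3_flow /=; congr pair; rewrite /= /GRing.scale /=; ring.
Qed.

(** Two functions are constant along every solution with control c:
    Y = exp(-mu t) (y + c) and
    Z = exp(-mu t) z - (c + kappa) (Y mu t + c exp(-mu t)).
    Their values determine the solution. *)
Lemma R2_flow_unique c (g : R -> R * R) (a b : R) : a <= b ->
  {within `[a, b], continuous g} ->
  (forall t : R, a < t < b -> is_derive t (1 : R) g
     (drift (R2_system mu kappa) (g t) +
      c *: control_field (R2_system mu kappa) (g t))) ->
  g b = R2_flow c (b - a) (g a).
Proof.
move=> ab gc gd.
have ec : continuous (fun t : R => expR (- mu * t)).
  move=> t; apply: differentiable_continuous; apply/derivable1_diffP.
  by case: (is_derive_expM (- mu) t).
have yc : {within `[a, b], continuous (fun t => (g t).1)}.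
  by exact: (@within_comp _ _ _ _ g fst gc (fun q => @cvg_fst _ _ _ _ _)).
have zc : {within `[a, b], continuous (fun t => (g t).2)}.
  by exact: (@within_comp _ _ _ _ g snd gc (fun q => @cvg_snd _ _ _ _ _)).
have ec' : {within `[a, b], continuous (fun t : R => expR (- mu * t))}.
  exact: continuous_subspaceT.
have tc : {within `[a, b], continuous (fun t : R => mu * t)}.
  by apply: continuous_subspaceT => t; apply: cvgM; [exact: cvg_cst|exact: cvg_id].
pose Y (t : R) := expR (- mu * t) * ((g t).1 + c).
pose Z (t : R) := expR (- mu * t) * (g t).2 -
  (c + kappa) * (Y t * (mu * t) + c * expR (- mu * t)).
have Yc : {within `[a, b], continuous Y}.
  by move=> x; apply: cvgM; [exact: ec'|apply: cvgD; [exact: yc|exact: cvg_cst]].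
have Zc : {within `[a, b], continuous Z}.
  move=> x; apply: cvgB; first by apply: cvgM; [exact: ec'|exact: zc].
  apply: cvgM; first exact: cvg_cst.
  apply: cvgD; first by apply: cvgM; [exact: Yc|exact: tc].
  by apply: cvgM; [exact: cvg_cst|exact: ec'].
have Yd (t : R) : a < t < b -> is_derive t 1 Y 0.
  move=> /gd h.
  refine (is_derive_eq (is_deriveMf (is_derive_expM (- mu) t)
    (is_deriveDf (is_derive_fstf h) (is_derive_cstf c t))) _).
  rewrite /= /GRing.scale /=; ring.
have Zd (t : R) : a < t < b -> is_derive t 1 Z 0.
  move=> tab; have h := gd _ tab; have dE := is_derive_expM (- mu) t.
  have dw := is_deriveDf (is_deriveMf (Yd t tab) (is_derive_mulr mu t))
    (is_deriveMf (is_derive_cstf c t) dE).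
  refine (is_derive_eq (is_deriveDf (is_deriveMf dE (is_derive_sndf h))
    (is_deriveNf (is_deriveMf (is_derive_cstf (c + kappa) t) dw))) _).
  rewrite /= /GRing.scale /= /Y; ring.
have eY := derive0_eq ab Yc Yd; have eZ := derive0_eq ab Zc Zd.
have eb : expR (mu * b) * expR (- mu * b) = 1.
  by rewrite -expRD mulNr subrr expR0.
have eE : expR (mu * (b - a)) = expR (mu * b) * expR (- mu * a).
  by rewrite -expRD; congr expR; ring.
have y_b : (g b).1 = expR (mu * b) * Y b - c.
  by rewrite /Y mulrA eb mul1r addrK.
have z_b : (g b).2 = expR (mu * b) * (Z b + (c + kappa) *
    (Y b * (mu * b) + c * expR (- mu * b))).
  by rewrite /Z subrK mulrA eb mul1r.
rewrite [LHS]surjective_pairing; congr pair.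
  by rewrite y_b eY /Y eE; ring.
apply/eqP; rewrite -subr_eq0; apply/eqP.
transitivity ((c + kappa) * c * (expR (mu * b) * expR (- mu * b) - 1)).
  by rewrite z_b eZ eY /= eE /Z /Y; ring.
by rewrite eb subrr mulr0.
Qed.

Lemma R3_flow_unique c (g : R -> R * (R * R)) (a b : R) : a <= b ->
  {within `[a, b], continuous g} ->
  (forall t : R, a < t < b -> is_derive t (1 : R) g
     (drift (R3_system mu kappa) (g t) +
      c *: control_field (R3_system mu kappa) (g t))) ->
  g b = R3_flow c (b - a) (g a).
Proof.
move=> ab gc gd; rewrite [LHS]surjective_pairing; congr pair; last first.
  apply: (R2_flow_unique (g := fun t => (g t).2)) => //.
    by exact: (@within_comp _ _ _ _ g snd gc (fun q => @cvg_snd _ _ _ _ _)).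
  by move=> t /gd /is_derive_sndf.
pose X (t : R) := (g t).1 - (mu * c) * t.
have Xc : {within `[a, b], continuous X}.
  have xc : {within `[a, b], continuous (fun t => (g t).1)}.
    by exact: (@within_comp _ _ _ _ g fst gc (fun q => @cvg_fst _ _ _ _ _)).
  have tc : {within `[a, b], continuous (fun t : R => mu * c * t)}.
    apply: continuous_subspaceT => t.
    by apply: cvgM; [exact: cvg_cst|exact: cvg_id].
  by move=> x; apply: cvgB; [exact: xc|exact: tc].
have Xd (t : R) : a < t < b -> is_derive t 1 X 0.
  move=> /gd h.
  refine (is_derive_eq (is_deriveDf (is_derive_fstf h)
    (is_deriveNf (is_derive_mulr (mu * c) t))) _).
  rewrite /= /GRing.scale /=; ring.
have := derive0_eq ab Xc Xd; rewrite /X => e.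
by rewrite -[LHS](subrK (mu * c * b)) e; ring.
Qed.

Lemma R2_flow_continuous c t : continuous (R2_flow c t).
Proof.
apply: continuous_pairf => q.
  apply: cvgB; last exact: cvg_cst.
  by apply: cvgM; [exact: cvg_cst|apply: cvgD; [exact: cvg_fst|exact: cvg_cst]].
apply: cvgD; first by apply: cvgM; [exact: cvg_cst|exact: cvg_snd].
apply: cvgM; first exact: cvg_cst.
apply: cvgB; last exact: cvg_cst.
apply: cvgM; last exact: cvg_cst.
apply: cvgM; last exact: cvg_cst.
by apply: cvgD; [exact: cvg_fst|exact: cvg_cst].
Qed.

Lemma R3_flow_continuous c t : continuous (R3_flow c t).
Proof.
apply: continuous_pairf => p.
  by apply: cvgD; [exact: cvg_fst|exact: cvg_cst].
apply: (@continuous_comp _ _ _ snd (R2_flow c t)); first exact: cvg_snd.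
exact: R2_flow_continuous.
Qed.

Lemma R2_flow0 c q : R2_flow c 0 q = q.
Proof. by case: q => y z; rewrite /R2_flow /= mulr0 expR0; congr pair; ring. Qed.

Lemma R2_has_flow : has_flow (R2_system mu kappa) R2_flow.
Proof.
split; [exact: R2_flow0 | exact: R2_flow_continuous | exact: R2_flow_derive |].
exact: R2_flow_unique.
Qed.

Lemma R3_has_flow : has_flow (R3_system mu kappa) R3_flow.
Proof.
split; [|exact: R3_flow_continuous | exact: R3_flow_derive | exact: R3_flow_unique].
by move=> c [x q]; rewrite /R3_flow /= R2_flow0 mulr0 addr0.
Qed.

Lemma R2_flowD c s t q : R2_flow c t (R2_flow c s q) = R2_flow c (s + t) q.
Proof. by rewrite /R2_flow /= (mulrDr mu s t) expRD; congr pair; ring. Qed.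

Lemma R3_flowD c s t p : R3_flow c t (R3_flow c s p) = R3_flow c (s + t) p.
Proof. by rewrite /R3_flow /= R2_flowD; congr pair; ring. Qed.

Lemma run_R3_snd s (p : R * (R * R)) : (run R3_flow s p).2 = run R2_flow s p.2.
Proof. by elim: s p => //= -[c t] s IH p; rewrite IH. Qed.

(** The variational equation of the planar part has the coefficient
    mu (c + kappa), whose integral is the displacement of x plus mu kappa t.
    Under a common control the difference of two solutions is therefore explicit,
    and it depends on the control only through that displacement. *)
Lemma run_R3_difference s (p p' : R * (R * R)) :
  let q := run R3_flow s p in let E := expR (mu * duration s) in
  run R3_flow s p' = (p'.1 + (q.1 - p.1),
   (q.2.1 + E * (p'.2.1 - p.2.1),
    q.2.2 + E * (p'.2.2 - p.2.2 +
      (p'.2.1 - p.2.1) * (q.1 - p.1 + mu * kappa * duration s)))).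
Proof.
elim: s p p' => [|[c t] s IH] p p' /=.
  rewrite duration_nil !mulr0 expR0; case: p' => x' [y' z'] /=.
  by congr pair; [ring|congr pair; ring].
rewrite (IH (R3_flow c t p)) duration_cons /= (mulrDr mu t) expRD /R3_flow/=.
by congr pair; [ring|congr pair; ring].
Qed.

End Flows.

(** * Local controllability of the planar system at equilibria *)
Section PlanarReachability.
Context {R : realType}.
Variables (lo hi mu kappa : R).
Hypotheses (lo_lt0 : lo < 0) (hi_gt0 : 0 < hi) (mu_neq0 : mu != 0).

Local Notation flow2 := (R2_flow mu kappa).
Local Notation reaches2 := (reaches lo hi flow2).
Local Notation eqm := (equilibrium kappa).

(** The control - kappa is excluded because the linearization of the planar system
    at its equilibrium is not controllable. *)
Definition good_control (u : R) : bool := (lo < u < hi) && (u != - kappa).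

Lemma good_bounds u : good_control u -> lo <= u <= hi.
Proof. by move=> /andP[/andP[h1 h2] _]; rewrite !ltW. Qed.

Lemma mulr_expRN_cvg0 : (fun x : R => x * expR (- x)) x @[x --> +oo] --> (0 : R).
Proof.
apply: (@squeeze_cvgr _ _ _ _ (fun=> 0) (fun x => 2 * expR (- (2^-1 * x)))).
- near=> x.
  have x0 : 0 <= x by near: x; exact: nbhs_pinfty_ge.
  rewrite mulr_ge0 ?expR_ge0//=.
  have -> : expR (- x) = expR (- (2^-1 * x)) * expR (- (2^-1 * x)).
    by rewrite -expRD; congr expR; lra.
  rewrite mulrA ler_wpM2r ?expR_ge0// expRN ler_pdivrMr ?expR_gt0//.
  have := expR_ge1Dx (2^-1 * x); lra.
- exact: cvg_cst.
- rewrite -[X in _ --> X](mulr0 2); apply: cvgM; first exact: cvg_cst.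
  apply: (@cvg_comp _ _ _ (fun x : R => 2^-1 * x) (fun x => expR (- x)) _ +oo%R).
    by apply: gt0_cvgMry => //; exact: cvg_id.
  exact: cvgr_expR.
Unshelve. all: by end_near. Qed.

(** The time - x / mu has the sign of - mu: equilibria attract in forward time if
    mu < 0 and in backward time if mu > 0. *)
Lemma flow2_cvg_equilibrium c q :
  flow2 c (- (x / mu)) q @[x --> +oo] --> eqm c.
Proof.
have e x : mu * - (x / mu) = - x by field.
have -> : eqm c = (0 * (q.1 + c) - c,
    0 * q.2 + (c + kappa) * (- (q.1 + c) * 0 - c * (0 - 1))).
  by rewrite /eqm; congr pair; ring.
have -> : (fun x => flow2 c (- (x / mu)) q) = (fun x =>
    (expR (- x) * (q.1 + c) - c, expR (- x) * q.2 + (c + kappa) *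
       (- (q.1 + c) * (x * expR (- x)) - c * (expR (- x) - 1)))).
  by apply/funext => x; rewrite /R2_flow e; congr pair; ring.
have h0 := @cvgr_expR R; have h1 := mulr_expRN_cvg0.
apply: cvg_pairf.
  apply: cvgB; last exact: cvg_cst.
  by apply: cvgM; [exact: h0|exact: cvg_cst].
apply: cvgD; first by apply: cvgM; [exact: h0|exact: cvg_cst].
apply: cvgM; first exact: cvg_cst.
apply: cvgB; first by apply: cvgM; [exact: cvg_cst|exact: h1].
by apply: cvgM; [exact: cvg_cst|apply: cvgB; [exact: h0|exact: cvg_cst]].
Qed.

Lemma flow2_near_equilibrium c q (B : set (R * R)) : nbhs (eqm c) B ->
  exists2 x, 0 <= x & B (flow2 c (- (x / mu)) q).
Proof.
move=> nB; near (pinfty_nbhs R) => x; exists x.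
  by near: x; exact: nbhs_pinfty_ge.
by near: x; exact: flow2_cvg_equilibrium nB.
Unshelve. all: by end_near. Qed.

Lemma expR_sub1_neq0 (x : R) : x != 0 -> expR x - 1 != 0.
Proof.
apply: contra_neq => /eqP; rewrite subr_eq0 => /eqP e.
by apply: (@expR_inj R); rewrite expR0.
Qed.

(** The end of two constant controls, each applied during the time sg / mu, so
    that mu t = sg. *)
Let two_step (sg c1 c2 : R) (p : R * R) : R * R :=
  let E := expR sg in
  let y1 := E * (p.1 + c1) - c1 in
  let z1 := E * p.2 + (c1 + kappa) * ((p.1 + c1) * sg * E - c1 * (E - 1)) in
  (E * (y1 + c2) - c2,
   E * z1 + (c2 + kappa) * ((y1 + c2) * sg * E - c2 * (E - 1))).

Lemma two_step_reaches (sg c1 c2 : R) (p : R * R) :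
  0 <= sg / mu -> lo <= c1 <= hi -> lo <= c2 <= hi ->
  reaches2 p (two_step sg c1 c2 p).
Proof.
move=> h h1 h2; exists [:: (c1, sg / mu); (c2, sg / mu)].
  by rewrite /= h1 h2 h.
have e : mu * (sg / mu) = sg by field.
by rewrite /= /R2_flow /two_step /= e.
Qed.

(** The second control that brings y to its prescribed final value; there is
    exactly one, because y is affine in it with slope exp(sg) - 1. *)
Let second_control (E c1 : R) (p p' : R * R) : R :=
  (p'.1 - E * (E * (p.1 + c1) - c1)) / (E - 1).

(** The error in z that remains, as a function of the first control. *)
Let gap (sg c1 : R) (p p' : R * R) : R :=
  (two_step sg c1 (second_control (expR sg) c1 p p') p).2 - p'.2.

Lemma two_step_fst sg c1 p p' : sg != 0 ->
  (two_step sg c1 (second_control (expR sg) c1 p p') p).1 = p'.1.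
Proof.
move=> sg0; have E1 := expR_sub1_neq0 sg0.
by rewrite /two_step /second_control /=; field.
Qed.

(** The coefficient (u + kappa) sg E (E - 1) of the linear term is nonzero: this
    is controllability of the linearization at the equilibrium of u. *)
Lemma gap_equilibrium sg u v : sg != 0 -> let E := expR sg in
  gap sg (u + v) (eqm u) (eqm u) =
  v * ((u + kappa) * (sg * E * (E - 1)) + v * (E * (2 * sg * E + 1 - E ^+ 2))).
Proof.
move=> sg0 E; have E1 : E - 1 != 0 := expR_sub1_neq0 sg0.
by rewrite /gap /two_step /second_control /equilibrium /= -/E; field.
Qed.

Lemma second_control_continuous E c1 :
  continuous (fun pp : (R * R) * (R * R) => second_control E c1 pp.1 pp.2).
Proof.
move=> pp; apply: cvgM; last exact: cvg_cst.
have h1 : (fun pp : (R * R) * (R * R) => pp.1.1) @ pp --> pp.1.1.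
  by apply: (@cvg_comp _ _ _ fst fst); exact: cvg_fst.
have h2 : (fun pp : (R * R) * (R * R) => pp.2.1) @ pp --> pp.2.1.
  by apply: (@cvg_comp _ _ _ snd fst); [exact: cvg_snd|exact: cvg_fst].
apply: cvgB; first exact: h2.
apply: cvgM; first exact: cvg_cst.
apply: cvgB; last exact: cvg_cst.
apply: cvgM; first exact: cvg_cst.
by apply: cvgD; [exact: h1|exact: cvg_cst].
Qed.

Lemma gap_continuous sg c1 :
  continuous (fun pp : (R * R) * (R * R) => gap sg c1 pp.1 pp.2).
Proof.
move=> pp.
have h1 : (fun pp : (R * R) * (R * R) => pp.1.1) @ pp --> pp.1.1.
  by apply: (@cvg_comp _ _ _ fst fst); exact: cvg_fst.
have h2 : (fun pp : (R * R) * (R * R) => pp.1.2) @ pp --> pp.1.2.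
  by apply: (@cvg_comp _ _ _ fst snd); [exact: cvg_fst|exact: cvg_snd].
have h3 : (fun pp : (R * R) * (R * R) => pp.2.2) @ pp --> pp.2.2.
  by apply: (@cvg_comp _ _ _ snd snd); exact: cvg_snd.
have hs := @second_control_continuous (expR sg) c1 pp.
have k (c : R) : (fun _ : (R * R) * (R * R) => c) @ pp --> c by exact: cvg_cst.
exact: (cvgB (cvgD (cvgM (k _) (cvgD (cvgM (k _) h2) (cvgM (k _)
  (cvgB (cvgM (cvgM (cvgD h1 (k _)) (k _)) (k _)) (k _)))))
  (cvgM (cvgD hs (k _)) (cvgB (cvgM (cvgM (cvgD (cvgB (cvgM (k _)
  (cvgD h1 (k _))) (k _)) hs) (k _)) (k _)) (cvgM hs (k _))))) h3).
Qed.

Lemma gap_continuous_control sg p p' : continuous (fun c1 => gap sg c1 p p').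
Proof.
move=> c1.
have i : (fun c : R => c) @ c1 --> c1 by exact: cvg_id.
have k (c : R) : (fun _ : R => c) @ c1 --> c by exact: cvg_cst.
have hs : (fun c => second_control (expR sg) c p p') @ c1 -->
    second_control (expR sg) c1 p p'.
  exact: (cvgM (cvgB (k _) (cvgM (k _) (cvgB (cvgM (k _) (cvgD (k _) i)) i))) (k _)).
exact: (cvgB (cvgD (cvgM (k _) (cvgD (k _) (cvgM (cvgD i (k _))
  (cvgB (cvgM (cvgM (cvgD (k _) i) (k _)) (k _)) (cvgM i (k _))))))
  (cvgM (cvgD hs (k _)) (cvgB (cvgM (cvgM (cvgD (cvgB (cvgM (k _)
  (cvgD (k _) i)) i) hs) (k _)) (k _)) (cvgM hs (k _))))) (k _)).
Qed.

(** For p = p' = equilibrium the gap changes sign between the first controls u - d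
    and u + d.  This persists for p and p' nearby, so the intermediate value
    theorem yields a first control for which the two steps lead from p to p'
    exactly. *)
Lemma local_controllability u : good_control u ->
  exists2 N, nbhs (eqm u) N & forall p p', N p -> N p' -> reaches2 p p'.
Proof.
move=> /andP[/andP[lou uhi] uk].
pose sg := Num.sg mu; pose E := expR sg.
have sg0 : sg != 0 by rewrite sgr_eq0.
have sgmu : 0 <= sg / mu.
  by rewrite /sg -{2}(mulr_sg_norm mu) invfM mulrA divff // mul1r invr_ge0.
have E0 : 0 < E by exact: expR_gt0.
have E1 : E - 1 != 0 := expR_sub1_neq0 sg0.
pose a := (u + kappa) * (sg * E * (E - 1)).
pose b := E * (2 * sg * E + 1 - E ^+ 2).
have a0 : a != 0.
  have uk0 : u + kappa != 0 by rewrite addr_eq0.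
  by rewrite /a !mulf_neq0// gt_eqF.
pose m := Num.min (u - lo) (hi - u).
have m0 : 0 < m by rewrite lt_min !subr_gt0 lou.
(* The first condition on d keeps both controls in range, the second one makes
   the linear term of the gap dominate. *)
have [d [d0 dm db]] : exists d, [/\ 0 < d, d * (1 + E) < m & d * `|b| < `|a| ].
  pose d1 := m / (1 + E); pose d2 := `|a| / (`|b| + 1).
  have b0 : 0 < `|b| + 1 by rewrite ltr_wpDl.
  have d10 : 0 < d1 by rewrite divr_gt0// addr_gt0.
  have d20 : 0 < d2 by rewrite divr_gt0// normr_gt0.
  exists (Num.min d1 d2 / 2); split.
  - by rewrite divr_gt0// lt_min d10.
  - rewrite -ltr_pdivlMr ?addr_gt0// -/d1.
    have : Num.min d1 d2 <= d1 by rewrite ge_min lexx.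
    lra.
  - apply: (@le_lt_trans _ _ (d2 / 2 * (`|b| + 1))).
      apply: ler_pM; [by rewrite divr_ge0// le_min !ltW|by []| |by rewrite lerDl].
      by rewrite ler_pM2r ?invr_gt0// ge_min lexx orbT.
    have e : d2 * (`|b| + 1) = `|a| by rewrite divfK// gt_eqF.
    have : 0 < `|a| by rewrite normr_gt0.
    by rewrite mulrAC e; lra.
have mlo : m <= u - lo by rewrite ge_min lexx.
have mhi : m <= hi - u by rewrite ge_min lexx orbT.
have dE : 0 < d * E by rewrite mulr_gt0.
have sc v : second_control E (u + v) (eqm u) (eqm u) = u - E * v.
  by rewrite /second_control /=; field.
pose w := (eqm u, eqm u).
have near_w (f : (R * R) * (R * R) -> R) (c : R) : continuous f -> f w < c ->
    nbhs w [set pp | f pp < c].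
  by move=> /(_ w) fc fwc; exact: (fc _ (lt_nbhsl fwc)).
have near_w' (f : (R * R) * (R * R) -> R) (c : R) : continuous f -> c < f w ->
    nbhs w [set pp | c < f pp].
  by move=> /(_ w) fc fwc; exact: (fc _ (lt_nbhsr fwc)).
have n1 : nbhs w [set pp | lo < second_control E (u + d) pp.1 pp.2].
  by apply: near_w'; [exact: second_control_continuous|rewrite sc; lra].
have n2 : nbhs w [set pp | second_control E (u - d) pp.1 pp.2 < hi].
  by apply: near_w; [exact: second_control_continuous|rewrite sc; lra].
have n3 : nbhs w [set pp |
    gap sg (u + d) pp.1 pp.2 * gap sg (u - d) pp.1 pp.2 < 0].
  apply: near_w.
    by move=> pp; apply: cvgM; exact: gap_continuous.
  rewrite /= !gap_equilibrium// -/E -/a -/b.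
  have -> : d * (a + d * b) * (- d * (a + - d * b)) =
      - (d ^+ 2 * (a ^+ 2 - (d * b) ^+ 2)) by ring.
  rewrite oppr_lt0 mulr_gt0 ?exprn_gt0// subr_gt0.
  by rewrite -[X in X < _]real_normK ?num_real// -[X in _ < X]real_normK ?num_real//
     ltr_pXn2r ?nnegrE// normrM gtr0_norm.
have : nbhs w ([set pp | lo < second_control E (u + d) pp.1 pp.2] `&`
   [set pp | second_control E (u - d) pp.1 pp.2 < hi] `&`
   [set pp | gap sg (u + d) pp.1 pp.2 * gap sg (u - d) pp.1 pp.2 < 0]).
  by apply: filterI => //; exact: filterI.
move=> [[N1 N2] [/= hN1 hN2] hN].
exists (N1 `&` N2); first exact: filterI.
move=> p p' [Np _] [_ Np'].
have [[/= l1 l2] l3] := hN (p, p') (conj Np Np').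
have du : u - d <= u + d by lra.
have cont := @continuous_subspaceT _ _ `[u - d, u + d]%classic _
  (@gap_continuous_control sg p p').
have [|c1] := IVT (v := 0) du cont.
  move: l3; rewrite ge_min le_max; set f1 := gap _ _ _ _; set f2 := gap _ _ _ _.
  have [h1|h1] := leP f1 0; have [h2|h2] := leP f2 0 => h; rewrite ?orbT//=.
  - by exfalso; nra.
  - by rewrite (ltW h2).
  - by rewrite (ltW h1) orbT.
  - by exfalso; nra.
rewrite in_itv/= => /andP[c1l c1u] gap0.
(* The second control decreases in c1, so its bounds follow from those at the
   ends of [u - d, u + d]. *)
have c2E : second_control E c1 p p' =
    second_control E (u + d) p p' + E * (u + d - c1).
  by rewrite /second_control; field.
have c2E' : second_control E c1 p p' =
    second_control E (u - d) p p' - E * (c1 - (u - d)).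
  by rewrite /second_control; field.
have -> : p' = two_step sg c1 (second_control E c1 p p') p.
  rewrite [RHS]surjective_pairing two_step_fst// [LHS]surjective_pairing.
  by congr pair; apply/esym/eqP; rewrite -subr_eq0; apply/eqP.
apply: two_step_reaches => //.
  have : 0 < d * E by []. by lra.
apply/andP; split.
  rewrite c2E; apply: ltW; apply: ltr_wpDr => //.
  by rewrite mulr_ge0 ?(ltW E0)// subr_ge0.
rewrite c2E' lerBlDr; apply: ler_wpDr; last exact: ltW.
by rewrite mulr_ge0 ?(ltW E0)// subr_ge0.
Qed.
End PlanarReachability.

(** * The control set of the planar system *)
Section PlanarControlSet.
Context {R : realType}.
Variables (lo hi mu kappa : R).
Hypotheses (lo_lt0 : lo < 0) (hi_gt0 : 0 < hi) (mu_neq0 : mu != 0).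

Local Notation S2 := (R2_system mu kappa).
Local Notation flow2 := (R2_flow mu kappa).
Local Notation reaches2 := (reaches lo hi flow2).
Local Notation eqm := (equilibrium kappa).
Local Notation good := (good_control lo hi kappa).

Let lo_lt_hi : lo < hi. Proof. exact: lt_trans hi_gt0. Qed.

Lemma exists_good_pos : exists2 u, good u & 0 < u.
Proof.
have l0 := lo_lt0; have h0 := hi_gt0.
have [h|h] := eqVneq (hi / 2) (- kappa).
  exists (hi / 3); last lra.
  apply/andP; split; first lra.
  by rewrite -h; apply/eqP => e; lra.
by exists (hi / 2); [rewrite /good_control h andbT; lra|lra].
Qed.

Lemma exists_good_neg : exists2 u, good u & u < 0.
Proof.
have l0 := lo_lt0; have h0 := hi_gt0.
have [h|h] := eqVneq (lo / 2) (- kappa).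
  exists (lo / 3); last lra.
  apply/andP; split; first lra.
  by rewrite -h; apply/eqP => e; lra.
by exists (lo / 2); [rewrite /good_control h andbT; lra|lra].
Qed.

Lemma reaches_equilibrium u (q : R * R) : mu < 0 -> good u -> reaches2 q (eqm u).
Proof.
move=> mu0 gu; have [N nN hN] := local_controllability mu_neq0 gu.
have [x x0 Nx] := flow2_near_equilibrium mu_neq0 q nN.
apply: reaches_trans (hN _ _ Nx (nbhs_singleton nN)).
apply: reaches_step; first exact: good_bounds gu.
by rewrite -mulrN -invrN divr_ge0// oppr_ge0 ltW.
Qed.

Lemma equilibrium_reaches u (q : R * R) : 0 < mu -> good u -> reaches2 (eqm u) q.
Proof.
move=> mu0 gu; have [N nN hN] := local_controllability mu_neq0 gu.
have [x x0 Nx] := flow2_near_equilibrium mu_neq0 q nN.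
apply: reaches_trans (hN _ _ (nbhs_singleton nN) Nx) _.
have {2}-> : q = flow2 u (x / mu) (flow2 u (- (x / mu)) q).
  by rewrite R2_flowD addNr R2_flow0.
by apply: reaches_step; [exact: good_bounds gu|rewrite divr_ge0// ltW].
Qed.

Lemma equilibria_communicate u v : good u -> good v -> reaches2 (eqm u) (eqm v).
Proof.
move=> gu gv; have [mu0|mu0] := ltP mu 0; first exact: reaches_equilibrium.
by apply: equilibrium_reaches => //; rewrite lt_neqAle eq_sym mu_neq0.
Qed.

(** The points in two-way approximate communication with all good equilibria.
    Every set with property (ii) that contains a good equilibrium lies in it. *)
Definition core : set (R * R) := [set p | forall u, good u ->
  closure (reaches2 (eqm u)) p /\ closure (reaches2 p) (eqm u)].

Lemma core_closure p q : core p -> closure (reaches2 p) q ->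
  closure (reaches2 q) p -> core q.
Proof.
have h := R2_has_flow mu kappa.
move=> Cp pq qp u gu; have [up pu] := Cp u gu.
by split; [exact: (closure_reaches_trans h up)|exact: (closure_reaches_trans h qp)].
Qed.

(** One good control suffices, since good equilibria reach one another. *)
Lemma core_of_closure u p : good u -> closure (reaches2 (eqm u)) p ->
  closure (reaches2 p) (eqm u) -> core p.
Proof.
have h := R2_has_flow mu kappa.
move=> gu up pu v gv; split.
  exact: (closure_reaches_shift h (equilibria_communicate gv gu)).
apply: (closure_reaches_trans h pu); apply: subset_closure.
exact: equilibria_communicate.
Qed.

(** Approximate becomes exact: near the equilibrium one can steer into it. *)
Lemma core_reaches u p : good u -> core p -> reaches2 p (eqm u).
Proof.
move=> gu /(_ u gu)[_ pu]; have [N nN hN] := local_controllability mu_neq0 gu.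
have [q [pq Nq]] := pu _ nN.
exact: reaches_trans pq (hN _ _ Nq (nbhs_singleton nN)).
Qed.

Lemma core_interior u : good u -> interior core (eqm u).
Proof.
move=> gu; have [N nN hN] := local_controllability mu_neq0 gu.
have Nu := nbhs_singleton nN.
apply: filterS nN => p Np.
by apply: (core_of_closure gu); apply: subset_closure; exact: hN.
Qed.

Lemma core_equilibrium u : good u -> core (eqm u).
Proof. by move=> /core_interior; exact: interior_subset. Qed.

Lemma flow2_equilibrium u t : flow2 u t (eqm u) = eqm u.
Proof. by rewrite /R2_flow /equilibrium /=; congr pair; ring. Qed.

Lemma core_between p q u : good u -> core p -> reaches2 p q ->
  reaches2 q (eqm u) -> core q.
Proof.
have h := R2_has_flow mu kappa.
move=> gu Cp pq qu; apply: (core_of_closure gu); last exact: subset_closure.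
have [up _] := Cp u gu.
by apply: (closure_reaches_trans h up); exact: subset_closure.
Qed.

Lemma core_pre_control_set : pre_control_set lo hi S2 core.
Proof.
have h := R2_has_flow mu kappa.
split => p Cp; last first.
  move=> q Cq; rewrite (positive_orbitE h)//.
  have [u gu _] := exists_good_pos.
  exact: (closure_reaches_shift h (core_reaches gu Cp)) (Cq u gu).1.
have [u gu _] := exists_good_pos.
have [s As su] := core_reaches gu Cp.
have [w [g [cw tg g0 _ hg]]] := run_trajectory h p lo_lt_hi (good_bounds gu) As.
exists w, g; split => // t /hg[[s1 [s2 [A1 A2 R1 R2]]]|[r r0 ->]].
  apply: (core_between gu Cp); first by exists s1.
  by exists s2; rewrite // R2.
by rewrite su flow2_equilibrium; exact: core_equilibrium.
Qed.

Lemma pre_control_set_sub_core u C' : good u -> pre_control_set lo hi S2 C' ->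
  C' (eqm u) -> C' `<=` core.
Proof.
have h := R2_has_flow mu kappa.
move=> gu [_ C'2] C'u p C'p; apply: (core_of_closure gu).
  by rewrite -(positive_orbitE h)//; exact: C'2.
by rewrite -(positive_orbitE h)//; exact: C'2.
Qed.

Lemma core_R2_control_set : R2_control_set lo hi mu kappa core.
Proof.
split; last by move=> u u1 u2; apply: core_interior; rewrite /good_control u1.
have [u gu _] := exists_good_pos.
split; [by exists (eqm u); exact: core_equilibrium|exact: core_pre_control_set|].
move=> C' pC' CC'; apply/seteqP; split => //.
exact: (pre_control_set_sub_core gu pC' (CC' _ (core_equilibrium gu))).
Qed.

Lemma R2_control_set_unique C : R2_control_set lo hi mu kappa C -> C = core.
Proof.
move=> [[_ pC maxC] iC]; have [u gu _] := exists_good_pos.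
have /andP[u1 u2] := gu.
have Cu : C (eqm u) := interior_subset (iC u u1 u2).
apply/esym/maxC; first exact: core_pre_control_set.
exact: (pre_control_set_sub_core gu).
Qed.

End PlanarControlSet.

(** * The control set of the spatial system *)
Section SpatialControlSet.
Context {R : realType}.
Variables (lo hi mu kappa : R).
Hypotheses (lo_lt0 : lo < 0) (hi_gt0 : 0 < hi) (mu_neq0 : mu != 0).

Local Notation S3 := (R3_system mu kappa).
Local Notation flow2 := (R2_flow mu kappa).
Local Notation flow3 := (R3_flow mu kappa).
Local Notation reaches2 := (reaches lo hi flow2).
Local Notation reaches3 := (reaches lo hi flow3).
Local Notation eqm := (equilibrium kappa).
Local Notation good := (good_control lo hi kappa).
Local Notation core := (core lo hi mu kappa).
Local Notation M := (R * (R * R))%type.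

Let lo_lt_hi : lo < hi. Proof. exact: lt_trans hi_gt0. Qed.
Let flow3P := R3_has_flow mu kappa.

Definition core3 : set M := snd @^-1` core.

Lemma reaches3_snd (P Q : M) : reaches3 P Q -> reaches2 P.2 Q.2.
Proof. by move=> [s As <-]; exists s; rewrite // run_R3_snd. Qed.

Lemma closure_reaches3_snd (P Q : M) :
  closure (reaches3 P) Q -> closure (reaches2 P.2) Q.2.
Proof.
move=> PQ B nB; have /PQ[Q' [PQ' BQ']] : nbhs Q (snd @^-1` B).
  exact: (@cvg_snd _ _ _ _ _ _ nB).
by exists Q'.2; split => //; exact: reaches3_snd.
Qed.

Lemma reaches2_lift (p q : R * R) : reaches2 p q ->
  exists d : R, forall x : R, reaches3 (x, p) (x + d, q).
Proof.
move=> [s As sq]; exists (run flow3 s (0, p)).1 => x; exists s => //.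
rewrite -sq -[p in run flow2 s p]/((0 : R, p).2) -run_R3_snd.
have /= -> := run_R3_difference mu kappa s (0, p) (x, p).
case: (run flow3 s (0, p)) => d [y z] /=.
by rewrite !subrr !mul0r addr0 !mulr0 !addr0 subr0.
Qed.

Lemma reaches3_wait (u t x : R) : good u -> 0 <= t ->
  reaches3 (x, eqm u) (x + mu * u * t, eqm u).
Proof.
move=> gu t0; exists [:: (u, t)]; first by rewrite /= (good_bounds gu) t0.
by rewrite /= /R3_flow /= flow2_equilibrium.
Qed.

(** Waiting at the equilibrium of u moves x at speed mu u and nothing else.  The
    path from p to q visits two equilibria whose controls have opposite signs;
    the waiting times there produce any displacement of x. *)
Lemma core_steer (u x x' : R) (p q : R * R) : good u -> core p ->
  reaches2 (eqm u) q -> reaches3 (x, p) (x', q).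
Proof.
move=> gu Cp uq.
have [up gup up0] := exists_good_pos kappa lo_lt0 hi_gt0.
have [um gum um0] := exists_good_neg kappa lo_lt0 hi_gt0.
have [d1 h1] := reaches2_lift (core_reaches mu_neq0 gup Cp).
have [d2 h2] := reaches2_lift (equilibria_communicate mu_neq0 gup gum).
have [d3 h3] := reaches2_lift
  (reaches_trans (equilibria_communicate mu_neq0 gum gu) uq).
pose D := (x' - x - d1 - d2 - d3) / mu.
have [t1 [t2 [t10 t20 e]]] : exists t1 t2 : R,
    [/\ 0 <= t1, 0 <= t2 & up * t1 + um * t2 = D].
  have [D0|D0] := leP 0 D.
    exists (D / up), 0; rewrite divr_ge0 ?(ltW up0)//; split => //.
    by rewrite mulr0 addr0 mulrC divfK// gt_eqF.
  exists 0, (D / um); split; [by []|by rewrite ler_ndivlMr ?mul0r// ltW|].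
  by rewrite mulr0 add0r mulrC divfK// lt_eqF.
apply: reaches_trans (h1 x) _.
apply: reaches_trans (reaches3_wait (x + d1) gup t10) _.
apply: reaches_trans (h2 _) _.
apply: reaches_trans (reaches3_wait _ gum t20) _.
have -> : x' = x + d1 + mu * up * t1 + d2 + mu * um * t2 + d3.
  have : mu * (up * t1 + um * t2) = x' - x - d1 - d2 - d3.
    by rewrite e /D mulrC divfK.
  by rewrite mulrDr !mulrA => h; lra.
exact: h3.
Qed.

Lemma core3_closure (P Q : M) : core3 P -> core3 Q -> closure (reaches3 P) Q.
Proof.
case: P Q => [x p] [x' q] Cp Cq B nB.
have [u gu _] := exists_good_pos kappa lo_lt0 hi_gt0.
have c : continuous (fun q : R * R => (x', q) : M).
  by apply: continuous_pairf => r; [exact: cvg_cst|exact: cvg_id].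
have /(Cq u gu).1[q' [uq' Bq']] := c q _ nB.
by exists (x', q'); split => //; exact: (core_steer _ _ gu).
Qed.

Lemma core3_pre_control_set : pre_control_set lo hi S3 core3.
Proof.
split => P CP; last by move=> Q CQ; rewrite (positive_orbitE flow3P)//; exact: core3_closure.
have [u gu _] := exists_good_pos kappa lo_lt0 hi_gt0.
have [s As su] := core_reaches mu_neq0 gu CP.
have [w [g [cw tg g0 _ hg]]] :=
  run_trajectory flow3P P lo_lt_hi (good_bounds gu) As.
have su3 : (run flow3 s P).2 = eqm u by rewrite run_R3_snd.
exists w, g; split => // t /hg[[s1 [s2 [A1 A2 R1 R2]]]|[r r0 ->]].
  rewrite /core3 /=; apply: (core_between mu_neq0 gu CP).
    by exists s1; rewrite // -run_R3_snd R1.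
  by exists s2; rewrite // -run_R3_snd R2.
by rewrite /core3 /= su3 flow2_equilibrium; exact: core_equilibrium.
Qed.

Lemma pre_control_set_meets_core3 (C' : set M) (P : M) :
  pre_control_set lo hi S3 C' -> C' P -> core3 P -> C' `<=` core3.
Proof.
move=> [_ C'2] C'P CP Q C'Q; apply: (core_closure CP); apply: closure_reaches3_snd.
  by rewrite -(positive_orbitE flow3P)//; exact: C'2.
by rewrite -(positive_orbitE flow3P)//; exact: C'2.
Qed.

Lemma core3_control_set : control_set lo hi S3 core3.
Proof.
have [u gu _] := exists_good_pos kappa lo_lt0 hi_gt0.
have Cu : core3 (0, eqm u) by exact: core_equilibrium.
split; [by exists (0, eqm u)|exact: core3_pre_control_set|].
move=> C' pC' CC'; apply/seteqP; split => //.
by apply: (pre_control_set_meets_core3 pC' _ Cu); exact: CC'.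
Qed.

Lemma control_set_meets_core3 (C' : set M) (P : M) :
  control_set lo hi S3 C' -> C' P -> core3 P -> C' = core3.
Proof.
move=> [_ pC' maxC'] C'P CP; apply/esym/maxC'; first exact: core3_pre_control_set.
exact: (pre_control_set_meets_core3 pC' C'P CP).
Qed.

End SpatialControlSet.

(** * Uniqueness for mu < 0 *)
Section Uniqueness.
Context {R : realType}.
Variables (lo hi mu kappa : R).
Hypotheses (lo_lt0 : lo < 0) (hi_gt0 : 0 < hi) (mu_neq0 : mu != 0).

Local Notation S3 := (R3_system mu kappa).
Local Notation flow2 := (R2_flow mu kappa).
Local Notation flow3 := (R3_flow mu kappa).
Local Notation reaches2 := (reaches lo hi flow2).
Local Notation reaches3 := (reaches lo hi flow3).
Local Notation eqm := (equilibrium kappa).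
Local Notation core := (core lo hi mu kappa).
Local Notation core3 := (core3 lo hi mu kappa).
Local Notation M := (R * (R * R))%type.

Let lo_lt_hi : lo < hi. Proof. exact: lt_trans hi_gt0. Qed.
Let flow3P := R3_has_flow mu kappa.

(** Differences of solutions with the same control decay.  Let the equilibrium w
    copy the controls of long almost closed loops at P: the copies end close to
    the ends of the loops, hence close to P, so P is in the closure of the orbit
    of w.  Decay is uniform over the loops because their displacement in x is
    almost 0. *)
Lemma pre_control_set_attracting (C' : set M) :
  mu < 0 -> pre_control_set lo hi S3 C' -> C' `<=` core3.
Proof.
move=> mu0 pC' P C'P; rewrite /core3 /=.
have [u gu _] := exists_good_pos kappa lo_lt0 hi_gt0.
set w := eqm u; set p := P.2.
apply: (core_of_closure mu_neq0 gu); last first.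
  by apply: subset_closure; exact: reaches_equilibrium.
move=> B nB.
pose E (t : R) := expR (mu * t).
(* The end of the copy of a loop at P that ends in Q after time t. *)
pose copy (Q : M) (t : R) : R * R :=
  (Q.2.1 + E t * (w.1 - p.1),
   Q.2.2 + E t * (w.2 - p.2 + (w.1 - p.1) * (Q.1 - P.1 + mu * kappa * t))).
have E0 : E t @[t --> +oo] --> (0 : R).
  have -> : E = (fun t => expR (- (- mu * t))).
    by apply/funext => t; rewrite /E mulNr opprK.
  apply: (@cvg_comp _ _ _ (fun t : R => - mu * t) (fun x => expR (- x)) _ +oo%R).
    by apply: gt0_cvgMry; [rewrite oppr_gt0|exact: cvg_id].
  exact: cvgr_expR.
have tE0 : t * E t @[t --> +oo] --> (0 : R).
  have -> : (fun t => t * E t) = (fun t => - mu^-1 * ((- mu * t) * expR (- (- mu * t)))).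
    by apply/funext => t; rewrite /E (_ : - (- mu * t) = mu * t); [field|ring].
  rewrite -[X in _ --> X](mulr0 (- mu^-1)); apply: cvgM; first exact: cvg_cst.
  apply: (@cvg_comp _ _ _ (fun t : R => - mu * t) (fun x => x * expR (- x)) _ +oo%R).
    by apply: gt0_cvgMry; [rewrite oppr_gt0|exact: cvg_id].
  exact: mulr_expRN_cvg0.
have hc : (fun Qt : M * R => copy Qt.1 Qt.2) @ filter_prod (nbhs P) +oo%R --> p.
  have h1 : (fun Qt : M * R => Qt.1) @ filter_prod (nbhs P) +oo%R --> P by exact: cvg_fst.
  have hx : (fun Qt : M * R => Qt.1.1) @ filter_prod (nbhs P) +oo%R --> P.1.
    by apply: cvg_comp h1 _; exact: cvg_fst.
  have h2 : (fun Qt : M * R => Qt.1.2) @ filter_prod (nbhs P) +oo%R --> p.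
    by apply: cvg_comp h1 _; exact: cvg_snd.
  have hy : (fun Qt : M * R => Qt.1.2.1) @ filter_prod (nbhs P) +oo%R --> p.1.
    by apply: cvg_comp h2 _; exact: cvg_fst.
  have hz : (fun Qt : M * R => Qt.1.2.2) @ filter_prod (nbhs P) +oo%R --> p.2.
    by apply: cvg_comp h2 _; exact: cvg_snd.
  have hE : (fun Qt : M * R => E Qt.2) @ filter_prod (nbhs P) +oo%R --> (0 : R).
    by apply: cvg_comp E0; exact: cvg_snd.
  have htE : (fun Qt : M * R => Qt.2 * E Qt.2) @ filter_prod (nbhs P) +oo%R --> (0 : R).
    by apply: (cvg_comp _ _ _ tE0); exact: cvg_snd.
  have k (c : R) : (fun _ : M * R => c) @ filter_prod (nbhs P) +oo%R --> c.
    exact: cvg_cst.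
  have -> : (fun Qt : M * R => copy Qt.1 Qt.2) = (fun Qt : M * R =>
      (Qt.1.2.1 + E Qt.2 * (w.1 - p.1),
       Qt.1.2.2 + (E Qt.2 * (w.2 - p.2) + (w.1 - p.1) *
         (E Qt.2 * (Qt.1.1 - P.1) + mu * kappa * (Qt.2 * E Qt.2))))).
    by apply/funext => Qt; rewrite /copy; congr pair; ring.
  rewrite [X in _ --> X](_ : p = (p.1 + 0 * (w.1 - p.1), p.2 + (0 * (w.2 - p.2) +
      (w.1 - p.1) * (0 * (P.1 - P.1) + mu * kappa * 0)))); last first.
    by rewrite [LHS]surjective_pairing; congr pair; ring.
  apply: cvg_pairf.
    exact: (cvgD hy (cvgM hE (k _))).
  exact: (cvgD hz (cvgD (cvgM hE (k _)) (cvgM (k _)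
    (cvgD (cvgM hE (cvgB hx (k _))) (cvgM (k _) htE))))).
have [[N A] /= [nN [T [_ hT]]] hNA] := hc _ nB.
have T0 : 0 <= Num.max 0 T + 1 by rewrite addr_ge0// le_max lexx.
have [s [As ds Ns]] := pre_control_set_return flow3P lo_lt_hi pC' C'P T0 nN.
exists (run flow2 s w); split; first by exists s.
have -> : run flow2 s w = copy (run flow3 s P) (duration s).
  have := run_R3_difference mu kappa s P (P.1, w).
  by rewrite -[X in run flow2 s X]/((P.1, w).2) -run_R3_snd => ->.
apply: (hNA (run flow3 s P, duration s)); split => //=.
apply: hT; apply: lt_le_trans ds.
have : T <= Num.max 0 T by rewrite le_max lexx orbT.
by lra.
Qed.

End Uniqueness.

(** * Uniqueness for mu > 0 *)
Section ExpandingUniqueness.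
Context {R : realType}.
Variables (lo hi mu kappa : R).
Hypotheses (lo_lt0 : lo < 0) (hi_gt0 : 0 < hi) (mu_gt0 : 0 < mu).

Local Notation S3 := (R3_system mu kappa).
Local Notation flow2 := (R2_flow mu kappa).
Local Notation flow3 := (R3_flow mu kappa).
Local Notation reaches3 := (reaches lo hi flow3).
Local Notation eqm := (equilibrium kappa).
Local Notation good := (good_control lo hi kappa).
Local Notation core := (core lo hi mu kappa).
Local Notation core3 := (core3 lo hi mu kappa).
Local Notation M := (R * (R * R))%type.
Implicit Types (P Q : M) (s : seq (R * R)).

Let lo_lt_hi : lo < hi. Proof. exact: lt_trans hi_gt0. Qed.
Let mu_neq0 : mu != 0. Proof. by rewrite gt_eqF. Qed.
Let flow3P := R3_has_flow mu kappa.

(** The function z - y ^ 2 / 2, normalized to vanish at the equilibrium of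
    - kappa, where it attains its minimum over the curve of equilibria. *)
Definition depth P : R := P.2.2 - P.2.1 * P.2.1 / 2 + kappa * kappa / 2.

(** It vanishes exactly on the curve of equilibria, and mu times it is the
    derivative of the depth along every trajectory, whatever the control. *)
Definition height P : R := P.2.2 - P.2.1 * P.2.1 + kappa * P.2.1.

(** For y >= - lo no control can make y decrease, so y stays there, and
    (x - y)' = - mu y <= mu lo. *)
Lemma upper_escape s P : admissible lo hi s -> - lo <= P.2.1 ->
  - lo <= (run flow3 s P).2.1 /\
  (run flow3 s P).1 - (run flow3 s P).2.1 <=
    P.1 - P.2.1 + mu * lo * duration s.
Proof.
elim: s P => [|[c t] s IH] P /=.
  by rewrite duration_nil mulr0 addr0.
move=> /andP[/andP[/andP[lc _] t0] As] yP.
have mt0 : 0 <= mu * t by rewrite mulr_ge0// ltW.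
have e1 := expR_ge1Dx (mu * t).
have yc : 0 <= P.2.1 + c by lra.
have y1 : - lo <= (flow3 c t P).2.1 by rewrite /=; nra.
have x1 : (flow3 c t P).1 - (flow3 c t P).2.1 <= P.1 - P.2.1 + mu * lo * t.
  rewrite /=; set E := expR _ in e1 *.
  have h1 : 0 <= (E - (1 + mu * t)) * (P.2.1 + c) by rewrite mulr_ge0// subr_ge0.
  have h2 : 0 <= (mu * t) * (P.2.1 + lo) by rewrite mulr_ge0//; lra.
  by rewrite -subr_ge0; have := addr_ge0 h1 h2; congr (_ <= _); ring.
have [h1 h2] := IH _ As y1; split => //.
by apply: (le_trans h2); rewrite duration_cons mulrDr addrA lerD2r.
Qed.

Lemma lower_escape s P : admissible lo hi s -> P.2.1 <= - hi ->
  (run flow3 s P).2.1 <= - hi /\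
  P.1 - P.2.1 + mu * hi * duration s <=
    (run flow3 s P).1 - (run flow3 s P).2.1.
Proof.
elim: s P => [|[c t] s IH] P /=.
  by rewrite duration_nil mulr0 addr0.
move=> /andP[/andP[/andP[_ ch] t0] As] yP.
have mt0 : 0 <= mu * t by rewrite mulr_ge0// ltW.
have e1 := expR_ge1Dx (mu * t).
have yc : 0 <= - (P.2.1 + c) by lra.
have y1 : (flow3 c t P).2.1 <= - hi by rewrite /=; nra.
have x1 : P.1 - P.2.1 + mu * hi * t <= (flow3 c t P).1 - (flow3 c t P).2.1.
  rewrite /=; set E := expR _ in e1 *.
  have h1 : 0 <= (E - (1 + mu * t)) * - (P.2.1 + c) by rewrite mulr_ge0// subr_ge0.
  have h2 : 0 <= (mu * t) * - (P.2.1 + hi) by rewrite mulr_ge0//; lra.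
  by rewrite -subr_ge0; have := addr_ge0 h1 h2; congr (_ <= _); ring.
have [h1 h2] := IH _ As y1; split => //.
by apply: le_trans h2; rewrite duration_cons mulrDr addrA lerD2r.
Qed.

Lemma flow3_derive_x c P (t : R) :
  is_derive t (1 : R) (fun r => (flow3 c r P).1) (mu * c).
Proof.
refine (is_derive_eq (is_derive_fstf (R3_flow_derive mu kappa c P t)) _).
by rewrite /= /GRing.scale /=; ring.
Qed.

Lemma flow3_derive_y c P (t : R) : is_derive t (1 : R)
  (fun r => (flow3 c r P).2.1) (mu * ((flow3 c t P).2.1 + c)).
Proof.
refine (is_derive_eq
  (is_derive_fstf (is_derive_sndf (R3_flow_derive mu kappa c P t))) _).
by rewrite /= /GRing.scale /=; ring.
Qed.

Lemma flow3_derive_z c P (t : R) : is_derive t (1 : R)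
  (fun r => (flow3 c r P).2.2)
  (mu * ((flow3 c t P).2.2 + (c + kappa) * (flow3 c t P).2.1)).
Proof.
refine (is_derive_eq
  (is_derive_sndf (is_derive_sndf (R3_flow_derive mu kappa c P t))) _).
by rewrite /= /GRing.scale /=; ring.
Qed.

Lemma flow3_derive_depth c P (t : R) : is_derive t (1 : R)
  (fun r => depth (flow3 c r P)) (mu * height (flow3 c t P)).
Proof.
have dy := flow3_derive_y c P t; have dz := flow3_derive_z c P t.
refine (is_derive_eq (is_deriveDf (is_deriveDf dz (is_deriveNf
  (is_deriveMf (is_deriveMf dy dy) (is_derive_cstf 2^-1 t))))
  (is_derive_cstf (kappa * kappa / 2) t)) _).
by rewrite /height; field.
Qed.

Lemma flow3_height_continuous c P : continuous (fun r : R => height (flow3 c r P)).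
Proof.
move=> t; apply: differentiable_continuous; apply/derivable1_diffP.
have dy := flow3_derive_y c P t; have dz := flow3_derive_z c P t.
by case: (is_deriveDf (is_deriveDf dz (is_deriveNf (is_deriveMf dy dy)))
  (is_deriveMf (is_derive_cstf kappa t) dy)).
Qed.

(** depth' = mu (depth - (y - kappa) ^ 2 / 2) <= mu depth. *)
Lemma depth_le s P : admissible lo hi s ->
  depth (run flow3 s P) <= expR (mu * duration s) * depth P.
Proof.
elim: s P => [|[c t] s IH] P /=.
  by rewrite duration_nil mulr0 expR0 mul1r.
move=> /andP[/andP[_ t0] As].
apply: (le_trans (IH _ As)); rewrite duration_cons /= (mulrDr mu) expRD [expR (mu * t) * _]mulrC -mulrA.
rewrite ler_wpM2l ?expR_ge0//=.
pose F r := expR (- mu * r) * depth (flow3 c r P).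
have dF (r : R) : is_derive r (1 : R) F (- (mu * expR (- mu * r) *
    (((flow3 c r P).2.1 - kappa) ^+ 2 / 2))).
  refine (is_derive_eq (is_deriveMf (is_derive_expM (- mu) r)
    (flow3_derive_depth c P r)) _).
  by rewrite /height /depth; field.
have : F t <= F 0.
  apply: (derive_le0_le t0 dF) => r _; rewrite oppr_le0 mulr_ge0//.
    by rewrite mulr_ge0 ?expR_ge0 ?ltW.
  by rewrite divr_ge0 ?sqr_ge0.
have [f0 _ _ _] := flow3P.
rewrite /F mulr0 expR0 mul1r f0 mulNr expRN mulrC ler_pdivrMr ?expR_gt0//.
by rewrite mulrC.
Qed.

Lemma depth_le0 s P : admissible lo hi s -> depth P <= 0 ->
  depth (run flow3 s P) <= 0.
Proof.
move=> As dP; apply: (le_trans (depth_le P As)).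
by rewrite mulr_ge0_le0 ?expR_ge0.
Qed.

(** Its derivative is mu (depth - y ^ 2 / 2 - kappa ^ 2 / 2), so where the depth
    is nonpositive it decreases at a rate bounded away from 0 unless
    kappa = 0. *)
Definition lyapunov P : R := kappa * (P.1 - P.2.1) + depth P.

Lemma lyapunov_le s P : admissible lo hi s -> depth P <= 0 ->
  lyapunov (run flow3 s P) <= lyapunov P - mu * (kappa ^+ 2 / 2) * duration s.
Proof.
elim: s P => [|[c t] s IH] P /=.
  by rewrite duration_nil mulr0 subr0.
move=> /andP[/andP[hc t0] As] dP.
have dr r : 0 <= r -> depth (flow3 c r P) <= 0.
  move=> r0; have := @depth_le0 [:: (c, r)] P.
  by rewrite /= hc r0; exact.
apply: (le_trans (IH _ As (dr _ t0))).
rewrite duration_cons mulrDr opprD addrA lerD2r /=.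
pose F r := lyapunov (flow3 c r P) + mu * (kappa ^+ 2 / 2) * r.
have dF (r : R) : is_derive r (1 : R) F
    (mu * (depth (flow3 c r P) - (flow3 c r P).2.1 ^+ 2 / 2)).
  refine (is_derive_eq (is_deriveDf (is_deriveDf (is_deriveMf
    (is_derive_cstf kappa r) (is_deriveDf (flow3_derive_x c P r)
    (is_deriveNf (flow3_derive_y c P r)))) (flow3_derive_depth c P r))
    (is_derive_mulr (mu * (kappa ^+ 2 / 2)) r)) _).
  by rewrite /height /depth; field.
have : F t <= F 0.
  apply: (derive_le0_le t0 dF) => r /andP[r0 _].
  rewrite pmulr_rle0// subr_le0; apply: (le_trans (dr _ r0)).
  by rewrite divr_ge0 ?sqr_ge0.
by have [f0 _ _ _] := flow3P; rewrite /F mulr0 addr0 f0 lerBrDr.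
Qed.

Definition strip : set M :=
  [set P | [/\ - hi < P.2.1, P.2.1 < - lo & 0 < depth P]].

(** The complement is a union of three forward invariant regions. *)
Lemma strip_backward s P : admissible lo hi s -> strip (run flow3 s P) -> strip P.
Proof.
move=> As [h1 h2 h3]; split; rewrite ltNge; apply/negP => h.
- by have [] := lower_escape As h; rewrite leNgt h1.
- by have [] := upper_escape As h; rewrite leNgt h2.
- by have := depth_le0 As h; rewrite leNgt h3.
Qed.

(** As equilibria reach every point when mu > 0, only the way back matters. *)
Lemma core3_of_reaches P Q : reaches3 P Q -> core3 Q -> core3 P.
Proof.
move=> PQ CQ; have [u gu _] := exists_good_pos kappa lo_lt0 hi_gt0.
apply: (core_of_closure mu_neq0 gu); apply: subset_closure.
  exact: equilibrium_reaches.
exact: reaches_trans (reaches3_snd PQ) (core_reaches mu_neq0 gu CQ).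
Qed.

(** Points of zero height are equilibria; those in the strip belong to good
    controls, because the equilibrium of the control - kappa has depth 0. *)
Lemma strip_height0 P : strip P -> height P = 0 -> core3 P.
Proof.
move=> [h1 h2 h3] h0.
have gu : good (- P.2.1).
  rewrite /good_control; apply/andP; split; first lra.
  apply: contraTneq h3 => e; rewrite -leNgt; move: h0.
  have ek : kappa = P.2.1 by rewrite -[LHS]opprK -e opprK.
  by rewrite /height /depth ek; lra.
have := core_equilibrium mu_neq0 gu; rewrite /core3 /=.
have -> // : eqm (- P.2.1) = P.2.
rewrite /equilibrium [RHS]surjective_pairing; congr pair; first by rewrite opprK.
by move: h0; rewrite /height; lra.
Qed.

(** Within the strip the height of a trajectory that starts off the control set
    cannot vanish, by [strip_height0]; it keeps its sign and the depth is strictly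
    monotone.  The real sigma stands for that sign; it will be the height at the
    starting point. *)
Lemma strip_step c t P (sigma : R) : lo <= c <= hi -> 0 <= t ->
  strip (flow3 c t P) -> ~ core3 P -> 0 < sigma * height P ->
  [/\ 0 < sigma * height (flow3 c t P),
      sigma * depth P <= sigma * depth (flow3 c t P)
    & 0 < t -> sigma * depth P < sigma * depth (flow3 c t P)].
Proof.
move=> hc t0 st nC sP; have [f0 _ _ _] := flow3P.
pose F r := sigma * height (flow3 c r P).
have Fc : continuous F.
  move=> r; apply: cvgM; first exact: cvg_cst.
  exact: flow3_height_continuous.
have sr r : 0 <= r <= t -> strip (flow3 c r P).
  move=> /andP[r0 rt]; apply: (@strip_backward [:: (c, t - r)]).
    by rewrite /= hc subr_ge0 rt.
  by rewrite /run /= R3_flowD addrC subrK.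
have F0 : 0 < F 0 by rewrite /F f0.
have Fpos r : 0 <= r <= t -> 0 < F r.
  move=> /andP[r0 rt]; rewrite ltNge; apply/negP => Fr.
  have [|r1] := @IVT R F 0 r 0 r0 (continuous_subspaceT Fc).
    by rewrite ge_min le_max Fr (ltW F0) orbT.
  rewrite in_itv/= => /andP[r10 r1r] /eqP.
  rewrite mulf_eq0 => /orP[/eqP s0|/eqP h0].
    by move: sP; rewrite s0 mul0r ltxx.
  apply: nC; apply: (@core3_of_reaches _ (flow3 c r1 P)).
    exact: reaches_step.
  by apply: strip_height0 => //; apply: sr; rewrite r10 (le_trans r1r).
have lt : 0 < t -> sigma * depth P < sigma * depth (flow3 c t P).
  move=> t0'.
  have dG (r : R) : is_derive r (1 : R) (fun r => sigma * depth (flow3 c r P))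
      (mu * F r).
    refine (is_derive_eq (is_deriveMf (is_derive_cstf sigma r)
      (flow3_derive_depth c P r)) _).
    by rewrite /F; ring.
  have := derive_gt0_lt t0' dG; rewrite f0; apply => r hr.
  by rewrite mulr_gt0// Fpos.
split => //; first by apply: Fpos; rewrite t0 lexx.
move: t0; rewrite le_eqVlt => /predU1P[<-|/lt/ltW//].
by rewrite f0.
Qed.

Lemma strip_monotone s P (sigma : R) : admissible lo hi s ->
  strip (run flow3 s P) -> ~ core3 P -> 0 < sigma * height P ->
  [/\ 0 < sigma * height (run flow3 s P),
      sigma * depth P <= sigma * depth (run flow3 s P)
    & 0 < duration s -> sigma * depth P < sigma * depth (run flow3 s P)].
Proof.
elim: s P => [|[c t] s IH] P /=.
  by move=> _ _ _ h; split=> //; rewrite duration_nil !ltxx.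
move=> /andP[/andP[hc t0] As] st nC sP.
have [h1 h2 h3] := strip_step hc t0 (strip_backward As st) nC sP.
have nC1 : ~ core3 (flow3 c t P).
  by move=> C1; apply: nC; apply: core3_of_reaches C1; exact: reaches_step.
have [k1 k2 k3] := IH _ As st nC1 h1.
split => //; first exact: le_trans k2.
rewrite duration_cons /= => d0.
move: t0; rewrite le_eqVlt => /predU1P[t0|/h3 h].
  by apply: (le_lt_trans h2); apply: k3; rewrite -t0 add0r in d0.
exact: lt_le_trans k2.
Qed.

Lemma near_gt (f : M -> R) P (a : R) : continuous f -> a < f P ->
  nbhs P [set Q | a < f Q].
Proof. by move=> /(_ P) fc aP; exact: (fc _ (lt_nbhsr aP)). Qed.

Lemma near_lt (f : M -> R) P (a : R) : continuous f -> f P < a ->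
  nbhs P [set Q | f Q < a].
Proof. by move=> /(_ P) fc aP; exact: (fc _ (lt_nbhsl aP)). Qed.

Lemma continuous_x : continuous (fun P => P.1). Proof. by move=> P; exact: cvg_fst. Qed.

Lemma continuous_y : continuous (fun P => P.2.1).
Proof. by move=> P; apply: (@cvg_comp _ _ _ snd fst); [exact: cvg_snd|exact: cvg_fst]. Qed.

Lemma continuous_z : continuous (fun P => P.2.2).
Proof. by move=> P; apply: (@cvg_comp _ _ _ snd snd); exact: cvg_snd. Qed.

Lemma continuous_xy : continuous (fun P => P.1 - P.2.1).
Proof. by move=> P; apply: cvgB; [exact: continuous_x|exact: continuous_y]. Qed.

Lemma continuous_depth : continuous depth.
Proof.
move=> P; apply: cvgD; last exact: cvg_cst.
apply: cvgB; first exact: continuous_z.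
apply: cvgM; last exact: cvg_cst.
by apply: cvgM; exact: continuous_y.
Qed.

Lemma continuous_lyapunov : continuous lyapunov.
Proof.
move=> P; apply: cvgD; last exact: continuous_depth.
by apply: cvgM; [exact: cvg_cst|exact: continuous_xy].
Qed.

(** Off the control set a monotone quantity excludes recurrence: x - y where y has
    left (- hi, - lo), the depth inside the strip, the Lyapunov function for
    nonpositive depth if kappa <> 0, and the depth itself if it is negative. *)
Lemma pre_control_set_expanding (C' : set M) P :
  pre_control_set lo hi S3 C' -> C' P -> ~ core3 P ->
  kappa = 0 /\ depth P = 0.
Proof.
move=> pC' C'P nC; have l0 := lo_lt0; have h0 := hi_gt0; have m0 := mu_gt0.
have ret (B : set M) : nbhs P B ->
    exists s, [/\ admissible lo hi s, 1 <= duration s & B (run flow3 s P)].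
  by move=> nB; exact: (pre_control_set_return flow3P lo_lt_hi pC' C'P ler01 nB).
have [yu|yu] := leP (- lo) P.2.1.
  exfalso; have [|s [As ds]] := ret [set Q | P.1 - P.2.1 + mu * lo < Q.1 - Q.2.1].
    by apply: near_gt; [exact: continuous_xy|rewrite gtrDl nmulr_llt0].
  have [_ h] := upper_escape As yu; rewrite /= ltNge => /negP; apply.
  have ml : mu * lo < 0 by rewrite pmulr_rlt0.
  by apply: (le_trans h); rewrite lerD2l; nra.
have [yl|yl] := leP P.2.1 (- hi).
  exfalso; have [|s [As ds]] := ret [set Q | Q.1 - Q.2.1 < P.1 - P.2.1 + mu * hi].
    by apply: near_lt; [exact: continuous_xy|rewrite ltrDl mulr_gt0].
  have [_ h] := lower_escape As yl; rewrite /= ltNge => /negP; apply.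
  have mh : 0 < mu * hi by rewrite mulr_gt0.
  by apply: le_trans h; rewrite lerD2l; nra.
have [dP|dP] := leP (depth P) 0.
  have k0 : kappa = 0.
    have [//|k0] := eqVneq kappa 0; exfalso.
    have r0 : 0 < mu * (kappa ^+ 2 / 2) by rewrite mulr_gt0// divr_gt0// exprn_even_gt0.
    have [|s [As ds]] := ret [set Q | lyapunov P - mu * (kappa ^+ 2 / 2) < lyapunov Q].
      by apply: near_gt; [exact: continuous_lyapunov|rewrite gtrDl oppr_lt0].
    rewrite /= ltNge => /negP; apply; apply: (le_trans (lyapunov_le As dP)).
    by rewrite lerD2l lerN2; nra.
  split=> //; apply/eqP; rewrite eq_le dP /= leNgt; apply/negP => dP0.
  have e1 : 1 < expR mu by rewrite expR_gt1.
  have [|s [As ds]] := ret [set Q | expR mu * depth P < depth Q].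
    by apply: near_gt; [exact: continuous_depth|nra].
  rewrite /= ltNge => /negP; apply; apply: (le_trans (depth_le P As)).
  by rewrite ler_nM2r// ler_expR; nra.
exfalso; have stP : strip P by split.
have hP : height P != 0 by apply/eqP => /(strip_height0 stP).
have sP : 0 < height P * height P by rewrite -expr2 exprn_even_gt0.
have nS : nbhs P strip.
  have n1 : nbhs P [set Q | - hi < Q.2.1] by apply: near_gt => //; exact: continuous_y.
  have n2 : nbhs P [set Q | Q.2.1 < - lo] by apply: near_lt => //; exact: continuous_y.
  have n3 : nbhs P [set Q | 0 < depth Q] by apply: near_gt => //; exact: continuous_depth.
  by apply: filterS (filterI (filterI n1 n2) n3) => Q [[? ?] ?]; split.
(* The first unit of time raises height P * depth by a fixed amount, which no
   continuation inside the strip can undo. *)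
have [s [As ds Cs]] := pre_control_set_run flow3P pC' C'P (@ler01 R).
have [_ /(_ _ Cs _ C'P)] := pC'; rewrite (positive_orbitE flow3P)// => clP.
have stQ : strip (run flow3 s P).
  have [_ [[s' As' <-] st]] := clP _ nS.
  exact: (strip_backward As' st).
have [k1 _ k3] := strip_monotone As stQ nC sP.
have {}k3 := k3 _; rewrite ds ltr01 in k3; have {}k3 := k3 isT.
have n4 : nbhs P [set Q | height P * depth Q < height P * depth (run flow3 s P)].
  apply: (near_lt (f := fun Q => height P * depth Q)) => //.
  by move=> Q; apply: cvgM; [exact: cvg_cst|exact: continuous_depth].
have [_ [[s' As' <-] [/= st' lt']]] := clP _ (filterI nS n4).
have nCQ : ~ core3 (run flow3 s P).
  by move=> CQ; apply: nC; apply: core3_of_reaches CQ; exists s.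
have [_ h _] := strip_monotone As' st' nCQ k1.
by rewrite ltNge h in lt'.
Qed.

End ExpandingUniqueness.

(** * Uniqueness of the spatial control set *)
Lemma core3_unique (R : realType) (lo hi mu kappa : R)
    (C' : set (R * (R * R))) :
  lo < 0 -> 0 < hi -> mu != 0 ->
  control_set lo hi (R3_system mu kappa) C' ->
  ~ degenerate mu kappa \/ interior C' !=set0 -> C' = core3 lo hi mu kappa.
Proof.
move=> l0 h0 mu0 cC' hyp.
have [[P C'P] pC' _] := cC'.
have [mun|mup] := ltP mu 0.
  apply: (control_set_meets_core3 l0 h0 mu0 cC' C'P).
  exact: (pre_control_set_attracting l0 h0 mu0 mun pC').
have {mup}mup : 0 < mu by rewrite lt_neqAle eq_sym mu0.
have [[Q [C'Q CQ]]|no] := pselect (exists Q, C' Q /\ core3 lo hi mu kappa Q).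
  exact: (control_set_meets_core3 l0 h0 mu0 cC' C'Q CQ).
exfalso.
have all0 Q : C' Q -> kappa = 0 /\ depth kappa Q = 0.
  move=> C'Q; apply: (pre_control_set_expanding l0 h0 mup pC' C'Q) => CQ.
  by apply: no; exists Q.
have [k0 _] := all0 _ C'P.
case: hyp => [|[Q nQ]]; first by apply; split.
(* Moving an interior point in the z direction changes its depth. *)
have c : continuous (fun t : R => (Q.1, (Q.2.1, Q.2.2 + t)) : R * (R * R)).
  apply: continuous_pairf => t; first exact: cvg_cst.
  apply: cvg_pairf; first exact: cvg_cst.
  by apply: cvgD; [exact: cvg_cst|exact: cvg_id].
have : nbhs (0 : R) [set t : R | C' (Q.1, (Q.2.1, Q.2.2 + t))].
  apply: (c 0); rewrite addr0 -!surjective_pairing; exact: nQ.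
move=> /nbhs_ballP[e /= e0] /(_ (e / 2)) he.
have e2 : 0 < e / 2 by rewrite divr_gt0.
have /all0[_] : C' (Q.1, (Q.2.1, Q.2.2 + e / 2)).
  by apply: he; rewrite /ball/= sub0r normrN gtr0_norm//; lra.
have [_] := all0 _ (interior_subset nQ).
by rewrite /depth /=; lra.
Qed.

(** * Transport of control sets by conjugations *)
Section Transport.
Context {R : realType} {V W : normedModType R}.
Variables (lo hi : R).

Definition maps_trajectories (V W : normedModType R) (S : control_affine V)
    (T : control_affine W) (f : V -> W) : Prop :=
  forall u g, trajectory S u g -> trajectory T u (f \o g).

Lemma positive_orbit_map (V' W' : normedModType R) (S : control_affine V')
    (T : control_affine W') (f : V' -> W') x y :
  maps_trajectories S T f -> positive_orbit lo hi S x y ->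
  positive_orbit lo hi T (f x) (f y).
Proof.
move=> mf [u [g [tau [cu tg g0 tau0 gt]]]].
by exists u, (f \o g), tau; rewrite /= g0 gt; split => //; exact: mf.
Qed.

Lemma pre_control_set_preimage (V' W' : normedModType R) (S : control_affine V')
    (T : control_affine W') (f : V' -> W') (h : W' -> V') (C : set W') :
  continuous h -> cancel f h -> cancel h f -> maps_trajectories T S h ->
  pre_control_set lo hi T C -> pre_control_set lo hi S (f @^-1` C).
Proof.
move=> ch fK hK mh [C1 C2]; split => x /= Cx.
  have [u [g [cu tg g0 Cg]]] := C1 _ Cx.
  exists u, (h \o g); split => //; first exact: mh.
    by rewrite /= g0 fK.
  by move=> t t0 /=; rewrite hK; exact: Cg.
move=> y /= Cy B nB.
have nhB : nbhs (f y) (h @^-1` B) by apply: ch; rewrite fK.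
have [y' [oy' By']] := C2 _ Cx _ Cy _ nhB.
exists (h y'); split => //.
by rewrite -[x]fK; exact: positive_orbit_map oy'.
Qed.

Variables (S : control_affine V) (T : control_affine W) (f : V -> W) (h : W -> V).
Hypotheses (cf : continuous f) (ch : continuous h).
Hypotheses (fK : cancel f h) (hK : cancel h f).
Hypotheses (mf : maps_trajectories S T f) (mh : maps_trajectories T S h).

Lemma control_set_preimage (C : set W) :
  control_set lo hi T C -> control_set lo hi S (f @^-1` C).
Proof.
move=> [[y Cy] pC maxC]; split.
- by exists (h y); rewrite /= hK.
- exact: (pre_control_set_preimage ch fK hK mh pC).
- move=> C' pC' CC'.
  have <- : h @^-1` C' = C.
    apply: maxC; first exact: (pre_control_set_preimage cf hK fK mf pC').
    by move=> z Cz; apply: CC'; rewrite /= hK.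
  by apply/seteqP; split => x /=; rewrite fK.
Qed.

End Transport.

Lemma conjugation_maps_trajectories (R : realType) (V W : normedModType R)
    (S : control_affine V) (T : control_affine W) (f : V -> W) :
  (forall p, differentiable f p) ->
  (forall p, 'd f p (drift S p) = drift T (f p)) ->
  (forall p, 'd f p (control_field S p) = control_field T (f p)) ->
  maps_trajectories S T f.
Proof.
move=> df fd fc u g [gc gd]; split.
  by apply: (within_comp gc) => p; exact: differentiable_continuous.
move=> t t0 /(gd _ t0) h.
have := is_derive_compd (df (g t)) h.
by rewrite linearD linearZ /= fd fc.
Qed.

(** By the chain rule the differential of [h] undoes that of [f], so it carries the
    vector fields back. *)
Lemma conjugation_inverse (R : realType) (V W : normedModType R)
    (S : control_affine V) (T : control_affine W) (f : V -> W) (h : W -> V) :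
  (forall p, differentiable f p) -> (forall q, differentiable h q) ->
  cancel f h -> cancel h f ->
  (forall p, 'd f p (drift S p) = drift T (f p)) ->
  (forall p, 'd f p (control_field S p) = control_field T (f p)) ->
  maps_trajectories T S h.
Proof.
move=> df dh fK hK fd fc.
have inv p v : 'd h (f p) ('d f p v) = v.
  have := diff_comp (df p) (dh (f p)).
  have -> : h \o f = id by apply/funext.
  move=> /(congr1 (fun k => k v)) /= <-.
  by have [_ ->] := is_diff_id p.
apply: conjugation_maps_trajectories => // q; rewrite -[in 'd h _](hK q).
  by rewrite -[in drift T _](hK q) -fd inv.
by rewrite -[in control_field T _](hK q) -fc inv.
Qed.

(** * Smooth maps built from linear ones *)
Section Smoothness.
Context {R : realType}.

Lemma is_diff_linear_map (V W : normedModType R) (f : V -> W) (x : V) :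
  linear f -> continuous f -> is_diff x f f.
Proof.
move=> lf cf; pose fM := GRing.isLinear.Build R V W *:%R f lf.
pose fL : {linear V -> W} := HB.pack f fM.
have -> : f = fL by [].
by apply: DiffDef; [exact: linear_differentiable|exact: diff_lin].
Qed.

Lemma smooth_continuous (V W : normedModType R) (f : V -> W) :
  smooth f -> continuous f.
Proof. by move=> /(_ 0%N). Qed.

Lemma smooth_differentiable (V W : normedModType R) (f : V -> W) x :
  smooth f -> differentiable f x.
Proof. by move=> /(_ 1%N)[/(_ x)]. Qed.

Lemma smooth_diff (V W : normedModType R) (f : V -> W) v :
  smooth f -> smooth (fun x => 'd f x v).
Proof. by move=> sf n; have [_ /(_ v)] := sf n.+1. Qed.

Lemma smooth_cst (V W : normedModType R) (c : W) : smooth (fun _ : V => c).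
Proof.
move=> n; elim: n c => [|n IH] c; first by move=> x; exact: cvg_cst.
split=> [x|v]; first exact: differentiable_cst.
have -> : (fun x : V => 'd (fun _ : V => c) x v) = (fun=> 0).
  by apply/funext => x; rewrite diff_cst.
exact: IH.
Qed.

Lemma smooth_linear_map (V W : normedModType R) (f : V -> W) :
  linear f -> continuous f -> smooth f.
Proof.
move=> lf cf [//|n]; split=> [x|v].
  by have [] := is_diff_linear_map x lf cf.
have -> : (fun x : V => 'd f x v) = (fun=> f v).
  by apply/funext => x; have [_ ->] := is_diff_linear_map x lf cf.
exact: smooth_cst.
Qed.

Lemma is_CnD (V W : normedModType R) n (f g : V -> W) :
  is_Cn n f -> is_Cn n g -> is_Cn n (fun x => f x + g x).
Proof.
elim: n f g => [|n IH] f g; first by move=> cf cg x; apply: cvgD; [exact: cf|exact: cg].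
move=> [df sf] [dg sg]; split=> [x|v]; first exact: differentiableD.
have -> : (fun x : V => 'd (fun y => f y + g y) x v) =
    (fun x => 'd f x v + 'd g x v).
  by apply/funext => x; rewrite diffD.
by apply: IH; [exact: sf|exact: sg].
Qed.

Lemma smoothD (V W : normedModType R) (f g : V -> W) :
  smooth f -> smooth g -> smooth (fun x => f x + g x).
Proof. by move=> sf sg n; apply: is_CnD. Qed.

(** The differentials of a product involve the factors themselves, hence the
    induction runs over factors that are smooth to all orders. *)
Lemma smoothM (V : normedModType R) (f g : V -> R) :
  smooth f -> smooth g -> smooth (fun x => f x * g x).
Proof.
move=> sf sg n; elim: n f g sf sg => [|n IH] f g sf sg.
  by move=> x; apply: cvgM; exact: smooth_continuous.
split=> [x|v]; first by apply: differentiableM; exact: smooth_differentiable.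
have -> : (fun x : V => 'd (fun y => f y * g y) x v) =
    (fun x => f x * 'd g x v + g x * 'd f x v).
  by apply/funext => x; rewrite diffM//; exact: smooth_differentiable.
by apply: is_CnD; apply: IH => //; exact: smooth_diff.
Qed.

Lemma smoothN (V : normedModType R) (f : V -> R) :
  smooth f -> smooth (fun x => - f x).
Proof.
move=> sf; have -> : (fun x => - f x) = (fun x => - 1 * f x).
  by apply/funext => x; rewrite mulN1r.
by apply: smoothM => //; exact: smooth_cst.
Qed.

Lemma smoothZl (V W : normedModType R) (f : V -> R) (w : W) :
  smooth f -> smooth (fun x => f x *: w).
Proof.
move=> sf n; elim: n f sf => [|n IH] f sf.
  by move=> x; apply: cvgZ; [exact: smooth_continuous|exact: cvg_cst].
split=> [x|v]; first by apply: differentiableZl; exact: smooth_differentiable.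
have -> : (fun x : V => 'd (fun y => f y *: w) x v) = (fun x => 'd f x v *: w).
  by apply/funext => x; rewrite diffZl//; exact: smooth_differentiable.
by apply: IH; exact: smooth_diff.
Qed.

Lemma smooth_pair (V W X : normedModType R) (f : V -> W) (g : V -> X) :
  smooth f -> smooth g -> smooth (fun x => (f x, g x)).
Proof.
move=> sf sg n; elim: n f g sf sg => [|n IH] f g sf sg.
  by apply: continuous_pairf; exact: smooth_continuous.
split=> [x|v]; first by apply: differentiable_pair; exact: smooth_differentiable.
have -> : (fun x : V => 'd (fun y => (f y, g y)) x v) =
    (fun x => ('d f x v, 'd g x v)).
  by apply/funext => x; rewrite diff_pair//; exact: smooth_differentiable.
by apply: IH; exact: smooth_diff.
Qed.

Lemma smooth_fst (V W : normedModType R) : smooth (fun p : V * W => p.1).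
Proof. by apply: smooth_linear_map => // p; exact: cvg_fst. Qed.

Lemma smooth_snd (V W : normedModType R) : smooth (fun p : V * W => p.2).
Proof. by apply: smooth_linear_map => // p; exact: cvg_snd. Qed.

Lemma linear_coord (i : 'I_2) : linear (fun p : heis R => p.1 i 0).
Proof. by move=> a p q; rewrite /= !mxE. Qed.

Lemma continuous_coord (i : 'I_2) : continuous (fun p : heis R => p.1 i 0).
Proof.
move=> p; apply: (@cvg_comp _ _ _ fst (fun v : 'cV[R]_2 => v i 0)).
  exact: cvg_fst.
exact: coord_continuous.
Qed.

Lemma smooth_coord (i : 'I_2) : smooth (fun p : heis R => p.1 i 0).
Proof. exact: smooth_linear_map (linear_coord i) (@continuous_coord i). Qed.

Lemma is_derive_linear_map (V W : normedModType R) (f : V -> W) (p w : V) :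
  linear f -> continuous f -> is_derive p w f (f w).
Proof.
move=> lf cf; have [df e] := is_diff_linear_map p lf cf.
by apply: DeriveDef; [exact: diff_derivable|rewrite deriveE// e].
Qed.

End Smoothness.

(** * Linear algebra of the normal form *)
Section NormalForm.
Context {R : realType}.

Lemma ord2_sum (F : 'I_2 -> R) : \sum_i F i = F 0 + F 1.
Proof.
rewrite big_ord_recl big_ord1; congr (_ + F _); exact/val_inj.
Qed.

Lemma dotpE (v w : 'cV[R]_2) : dotp v w = v 0 0 * w 0 0 + v 1 0 * w 1 0.
Proof. exact: ord2_sum. Qed.

Lemma mulmx2E (P : 'M[R]_2) (v : 'cV[R]_2) i :
  (P *m v) i 0 = P i 0 * v 0 0 + P i 1 * v 1 0.
Proof. by rewrite mxE ord2_sum. Qed.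

Lemma mxtrace2 (A : 'M[R]_2) : \tr A = A 0 0 + A 1 1.
Proof. exact: ord2_sum. Qed.

Lemma det2 (A : 'M[R]_2) : \det A = A 0 0 * A 1 1 - A 0 1 * A 1 0.
Proof.
rewrite (expand_det_row _ 0) ord2_sum /cofactor !det_mx11 !mxE /=.
rewrite expr0 expr1 mul1r mulN1r mulrN.
have -> : lift 0 0 = 1 :> 'I_2 by apply/val_inj.
by have -> : lift 1 0 = 0 :> 'I_2 by apply/val_inj.
Qed.

Lemma omegaE (v w : 'cV[R]_2) : omega v w = v 0 0 * w 1 0 - w 0 0 * v 1 0.
Proof.
have l i : (row_mx v w : 'M[R]_2) i 0 = v i 0.
  by rewrite -(row_mxEl v w i 0); congr (row_mx v w i _); exact/val_inj.
have r i : (row_mx v w : 'M[R]_2) i 1 = w i 0.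
  by rewrite -(row_mxEr v w i 0); congr (row_mx v w i _); exact/val_inj.
by rewrite /omega det2 !l !r.
Qed.

Lemma cV2P (v w : 'cV[R]_2) : v 0 0 = w 0 0 -> v 1 0 = w 1 0 -> v = w.
Proof.
move=> h0 h1; apply/colP => -[[|[|//]] hi].
  by have -> : Ordinal hi = 0 by apply/val_inj.
by have -> : Ordinal hi = 1 by apply/val_inj.
Qed.

Lemma mulmx22 (P Q : 'M[R]_2) i j :
  (P *m Q) i j = P i 0 * Q 0 j + P i 1 * Q 1 j.
Proof. by rewrite mxE ord2_sum. Qed.

Lemma mx22P (A B : 'M[R]_2) : A 0 0 = B 0 0 -> A 0 1 = B 0 1 ->
  A 1 0 = B 1 0 -> A 1 1 = B 1 1 -> A = B.
Proof.
move=> h00 h01 h10 h11; apply/matrixP => i j.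
have o (k : 'I_2) : k = 0 \/ k = 1.
  by case: k => -[|[|//]] hk; [left|right]; exact/val_inj.
by have [-> | ->] := o i; have [-> | ->] := o j.
Qed.

Lemma scaled_delta_mulmx (mu : R) (w : 'cV[R]_2) :
  ((mu *: delta_mx 1 1 : 'M[R]_2) *m w) 0 0 = 0 /\
  ((mu *: delta_mx 1 1 : 'M[R]_2) *m w) 1 0 = mu * w 1 0.
Proof. by rewrite !mulmx2E !mxE /=; split; ring. Qed.

Lemma scaled_delta_trace (mu : R) : \tr (mu *: delta_mx 1 1 : 'M[R]_2) = mu.
Proof. by rewrite mxtrace2 !mxE /=; ring. Qed.

(** Otherwise the center would be an invariant subalgebra containing Z. *)
Lemma LARC_zeta_neq0 (A : 'M[R]_2) (eta zeta : 'cV[R]_2) (alpha : R) :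
  LARC A eta (zeta, alpha) -> zeta != 0.
Proof.
move=> L; apply/eqP => z0.
have : [set X : heis R | X.1 = 0] = setT.
  apply: L => /=; [split => //=| |exact: z0].
  - by move=> X Y -> ->; rewrite addr0.
  - by move=> c X ->; rewrite scaler0.
  - by move=> X ->; rewrite mulmx0.
move=> /seteqP[_ /(_ (const_mx 1, 0) I)] /= /matrixP /(_ 0 0).
by rewrite !mxE => /eqP; rewrite oner_eq0.
Qed.

(** Otherwise the kernel of the i-th row of P, times the center, would be an
    invariant subalgebra containing Z. *)
Lemma LARC_coord_neq0 (A : 'M[R]_2) (eta zeta : 'cV[R]_2) (alpha : R)
    (P : 'M[R]_2) (i : 'I_2) :
  LARC A eta (zeta, alpha) -> P \in unitmx ->
  (forall v : 'cV[R]_2, (P *m v) i 0 = 0 -> (P *m (A *m v)) i 0 = 0) ->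
  (P *m zeta) i 0 != 0.
Proof.
move=> L uP inv; apply/eqP => z0.
have : [set X : heis R | (P *m X.1) i 0 = 0] = setT.
  apply: L => /=; [split => /=| |exact: z0].
  - by rewrite mulmx0 mxE.
  - by move=> X Y hX hY; rewrite mulmxDr mxE hX hY addr0.
  - by move=> c X hX; rewrite -scalemxAr mxE hX mulr0.
  - by move=> X Y _ _; rewrite mulmx0 mxE.
  - by move=> X; exact: inv.
move=> /seteqP[_ /(_ (invmx P *m delta_mx i 0, 0) I)] /=.
by rewrite mulmxA mulmxV// mul1mx mxE !eqxx => /eqP; rewrite oner_eq0.
Qed.

(** A singular matrix satisfies A ^ 2 = (tr A) A, so a nonzero row of A is a left
    eigenvector for tr A; a row of the adjugate is one for 0. *)
Lemma diagonalization (A : 'M[R]_2) : \det A = 0 -> \tr A != 0 ->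
  exists2 P : 'M[R]_2, P \in unitmx & P *m A = (\tr A *: delta_mx 1 1) *m P.
Proof.
rewrite det2 mxtrace2 => d0 t0.
set mu := A 0 0 + A 1 1 in t0 *.
pose Q (a b c d : R) : 'M[R]_2 :=
  \matrix_(i, j) (if i == 0 then (if j == 0 then a else b)
                  else (if j == 0 then c else d)).
have key a b c d : a * d - b * c != 0 ->
    a * A 0 0 + b * A 1 0 = 0 -> a * A 0 1 + b * A 1 1 = 0 ->
    c * A 0 0 + d * A 1 0 = mu * c -> c * A 0 1 + d * A 1 1 = mu * d ->
    exists2 P : 'M[R]_2, P \in unitmx & P *m A = (mu *: delta_mx 1 1) *m P.
  move=> hd h1 h2 h3 h4; exists (Q a b c d).
    by rewrite unitmxE det2 !mxE /= unitfE.
  by apply: mx22P; rewrite !mulmx22 !mxE /= ?h1 ?h2 ?h3 ?h4; ring.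
(* If A 0 0 is nonzero, the determinant of P is - A 0 0 * mu; otherwise it is
   mu ^ 2, as then A 1 1 = mu. *)
have [a0|a0] := eqVneq (A 0 0) 0.
  apply: (key (A 1 1) (- A 0 1) (A 1 0) (A 1 1)); rewrite /mu.
  - have -> : A 1 1 * A 1 1 - - A 0 1 * A 1 0 = mu * mu.
      by rewrite /mu a0; move: d0; rewrite a0; lra.
    by rewrite mulf_neq0.
  - by move: d0; lra.
  - by ring.
  - by ring.
  - by move: d0; lra.
apply: (key (- A 1 0) (A 0 0) (A 0 0) (A 0 1)); rewrite /mu.
- have -> : - A 1 0 * A 0 1 - A 0 0 * A 0 0 = - (A 0 0 * mu).
    by rewrite /mu; move: d0; lra.
  by rewrite oppr_eq0 mulf_neq0.
- by ring.
- by move: d0; lra.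
- by move: d0; lra.
- by ring.
Qed.

Lemma exists_normal_form (A : 'M[R]_2) (eta zeta : 'cV[R]_2) (alpha : R) :
  zeta != 0 -> \det A = 0 -> \tr A != 0 ->
  exists (P : 'M[R]_2) (xi zeta' eta' : 'cV[R]_2),
    normal_form_data A eta zeta alpha P xi zeta' eta'.
Proof.
move=> z0 dA tA; have [P uP PA] := diagonalization dA tA.
have zz : dotp zeta zeta != 0.
  apply: contra_neq z0; rewrite dotpE -!expr2 => h.
  have h0 : zeta 0 0 ^+ 2 = 0 by have := sqr_ge0 (zeta 0 0); have := sqr_ge0 (zeta 1 0); lra.
  have h1 : zeta 1 0 ^+ 2 = 0 by have := sqr_ge0 (zeta 0 0); lra.
  by apply: cV2P; rewrite !mxE; apply/eqP; rewrite -sqrf_eq0; apply/eqP.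
(* xi removes the central component of Z; eta' is then forced. *)
pose xi := - (\det P * alpha / dotp zeta zeta) *: zeta.
pose r := xi^T *m A + \det P *: eta^T - \tr A *: xi^T.
exists P, xi, (- (P *m zeta)), ((r *m invmx P)^T); split => //.
- have dotp_mx (v w : 'cV[R]_2) : dotp v w = (v^T *m w) 0 0.
    by rewrite dotpE mxE ord2_sum !mxE.
  move=> [v c]; rewrite /heis_aut /derivation /= scaled_delta_trace.
  congr pair; first by rewrite !mulmxA PA.
  rewrite [dotp _ (P *m v)]dotp_mx trmxK -mulmxA mulKmx// /r.
  rewrite mulmxBl mulmxDl !mxE !ord2_sum !dotpE !mulmx2E !mxE !ord2_sum !mxE; ring.
rewrite /heis_aut /= opprK; congr pair.
have dotpZl (k : R) (v w : 'cV[R]_2) : dotp (k *: v) w = k * dotp v w.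
  by rewrite !dotpE !mxE; ring.
by rewrite dotpZl mulNr divfK// addNr.
Qed.

End NormalForm.

(** * The normalization is a conjugation *)
Section Normalization.
Context {R : realType}.
Variables (A P : 'M[R]_2) (eta zeta xi zeta' eta' : 'cV[R]_2) (alpha : R).
Hypothesis nf : normal_form_data A eta zeta alpha P xi zeta' eta'.
Hypotheses (tA : \tr A != 0) (z0_neq0 : zeta' 0 0 != 0) (z1_neq0 : zeta' 1 0 != 0).

Local Notation mu := (\tr A).
Local Notation kappa := (eta' 1 0 / zeta' 0 0).
Local Notation Psi := (normalization mu P xi zeta' eta').
Local Notation SH := (heis_system A eta zeta alpha).
Local Notation SR3 := (R3_system mu kappa).

(** The coordinates (x, y, z) of the normal form: the group inverse composed with
    the automorphism (P, xi). *)
Let nx (p : heis R) : R := - (P *m p.1) 0 0.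
Let ny (p : heis R) : R := - (P *m p.1) 1 0.
Let nz (p : heis R) : R := - (dotp xi p.1 + \det P * p.2).

Let psi3 (p : heis R) : R :=
  mu ^+ 2 / (zeta' 0 0 * zeta' 1 0) *
   (nz p + 2^-1 * (nx p * ny p) +
    eta' 0 0 / (mu * zeta' 1 0) * (zeta' 1 0 * nx p + - (zeta' 0 0 * ny p))).

Lemma normalizationE : Psi = (fun p : heis R =>
  (mu / zeta' 0 0 * nx p, (mu / zeta' 1 0 * ny p, psi3 p))).
Proof.
apply/funext => p; rewrite /normalization /heis_to_R3 /= /psi3 !mxE.
by rewrite /nx /ny /nz !mxE -[2^-1 * _ * _]mulrA.
Qed.

Lemma smooth_row i : smooth (fun p : heis R => - (P *m p.1) i 0).
Proof.
have -> : (fun p : heis R => - (P *m p.1) i 0) =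
    (fun p => - (P i 0 * p.1 0 0 + P i 1 * p.1 1 0)).
  by apply/funext => p; rewrite mulmx2E.
apply: smoothN; apply: smoothD; apply: smoothM;
  by [exact: smooth_cst|exact: smooth_coord].
Qed.

Lemma smooth_nz : smooth nz.
Proof.
have -> : nz = (fun p => - (xi 0 0 * p.1 0 0 + xi 1 0 * p.1 1 0 + \det P * p.2)).
  by apply/funext => p; rewrite /nz dotpE.
apply: smoothN; apply: smoothD; last first.
  by apply: smoothM; [exact: smooth_cst|exact: smooth_snd].
by apply: smoothD; apply: smoothM; by [exact: smooth_cst|exact: smooth_coord].
Qed.

Lemma smooth_psi3 : smooth psi3.
Proof.
have s0 := smooth_row 0; have s1 := smooth_row 1; have s2 := smooth_nz.
have k (c : R) : smooth (fun _ : heis R => c) by exact: smooth_cst.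
apply: smoothM; first exact: k.
apply: smoothD.
  apply: smoothD; first exact: s2.
  by apply: smoothM; [exact: k|exact: smoothM].
apply: smoothM; first exact: k.
by apply: smoothD; [|apply: smoothN]; apply: smoothM; by [exact: k|].
Qed.

Lemma smooth_normalization : smooth Psi.
Proof.
rewrite normalizationE; apply: smooth_pair.
  by apply: smoothM; [exact: smooth_cst|exact: smooth_row].
apply: smooth_pair; last exact: smooth_psi3.
by apply: smoothM; [exact: smooth_cst|exact: smooth_row].
Qed.

Let vec (x y : R) : 'cV[R]_2 := \col_i (if i == 0 then - x else - y).

Let inv_x (q : R * (R * R)) : R := zeta' 0 0 / mu * q.1.
Let inv_y (q : R * (R * R)) : R := zeta' 1 0 / mu * q.2.1.
Let inv_z (q : R * (R * R)) : R :=
  zeta' 0 0 * zeta' 1 0 / mu ^+ 2 * q.2.2 + - (2^-1 * (inv_x q * inv_y q)) +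
  - (eta' 0 0 / (mu * zeta' 1 0) * (zeta' 1 0 * inv_x q + - (zeta' 0 0 * inv_y q))).

Definition denormalization (q : R * (R * R)) : heis R :=
  let v := invmx P *m vec (inv_x q) (inv_y q) in
  (v, (- inv_z q - dotp xi v) / \det P).

Lemma invmx_vec x y : invmx P *m vec x y =
  (- x) *: col 0 (invmx P) + (- y) *: col 1 (invmx P).
Proof. by apply: cV2P; rewrite mulmx2E !mxE /= mulrC [in X in _ + X]mulrC. Qed.

Lemma smooth_denormalization : smooth denormalization.
Proof.
have k (c : R) : smooth (fun _ : R * (R * R) => c) by exact: smooth_cst.
have sx0 : smooth (fun q : R * (R * R) => q.1) by exact: smooth_fst.
have sy0 : smooth (fun q : R * (R * R) => q.2.1).
  apply: smooth_linear_map => // q.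
  by apply: (@cvg_comp _ _ _ snd fst); [exact: cvg_snd|exact: cvg_fst].
have sz0 : smooth (fun q : R * (R * R) => q.2.2).
  apply: smooth_linear_map => // q.
  by apply: (@cvg_comp _ _ _ snd snd); exact: cvg_snd.
have sx : smooth inv_x by apply: smoothM; [exact: k|exact: sx0].
have sy : smooth inv_y by apply: smoothM; [exact: k|exact: sy0].
have sz : smooth inv_z.
  apply: smoothD.
    apply: smoothD; first by apply: smoothM; [exact: k|exact: sz0].
    by apply: smoothN; apply: smoothM; [exact: k|exact: smoothM].
  apply: smoothN; apply: smoothM; first exact: k.
  by apply: smoothD; [|apply: smoothN]; apply: smoothM; by [exact: k|].
have -> : denormalization = (fun q : R * (R * R) =>
    ((- inv_x q) *: col 0 (invmx P) + (- inv_y q) *: col 1 (invmx P),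
     (- inv_z q + (inv_x q * dotp xi (col 0 (invmx P)) +
       inv_y q * dotp xi (col 1 (invmx P)))) * (\det P)^-1)).
  apply/funext => q; rewrite /denormalization invmx_vec; congr (_, _ * _).
  by rewrite !dotpE !mxE; ring.
apply: smooth_pair.
  by apply: smoothD; apply: smoothZl; exact: smoothN.
apply: smoothM; last exact: k.
apply: smoothD; first exact: smoothN.
by apply: smoothD; apply: smoothM.
Qed.

Let uP : P \in unitmx. Proof. by case: nf. Qed.
Let detP : \det P != 0. Proof. by move: uP; rewrite unitmxE unitfE. Qed.

Lemma normalizationK : cancel Psi denormalization.
Proof.
move=> p; rewrite normalizationE /denormalization.
set q := (mu / zeta' 0 0 * nx p, _); have ex : inv_x q = nx p by rewrite /inv_x /=; field; exact/andP.
have ey : inv_y q = ny p by rewrite /inv_y /=; field; exact/andP.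
have ez : inv_z q = nz p.
  by rewrite /inv_z ex ey /= /psi3; field; apply/and3P.
have ev : vec (inv_x q) (inv_y q) = P *m p.1.
  by rewrite ex ey /nx /ny; apply: cV2P; rewrite mxE /= opprK.
rewrite ev mulKmx// ez /nz [RHS]surjective_pairing; congr pair.
by field.
Qed.

Lemma denormalizationK : cancel denormalization Psi.
Proof.
move=> q; rewrite normalizationE.
set p := denormalization q.
have ev : P *m p.1 = vec (inv_x q) (inv_y q) by rewrite /p /= mulKVmx.
have ex : nx p = inv_x q by rewrite /nx ev mxE opprK.
have ey : ny p = inv_y q by rewrite /ny ev mxE opprK.
have ez : nz p = inv_z q by rewrite /nz {2}/p /=; field.
rewrite /psi3 ex ey ez [RHS]surjective_pairing [q.2]surjective_pairing.
by congr (_, (_, _)); rewrite /inv_z /inv_x /inv_y; field;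
  rewrite ?z0_neq0 ?z1_neq0 ?tA.
Qed.

Lemma linear_row i : linear (fun p : heis R => - (P *m p.1) i 0).
Proof. by move=> a p q; rewrite /= mulmxDr -scalemxAr !mxE; rewrite opprD -mulrN. Qed.

Lemma linear_nz : linear nz.
Proof. by move=> a p q; rewrite /nz /= !dotpE !mxE /GRing.scale /=; ring. Qed.

Lemma diff_normalization p w : 'd Psi p w =
  (mu / zeta' 0 0 * nx w, (mu / zeta' 1 0 * ny w,
   mu ^+ 2 / (zeta' 0 0 * zeta' 1 0) *
   (nz w + 2^-1 * (nx p * ny w + ny p * nx w) +
    eta' 0 0 / (mu * zeta' 1 0) * (zeta' 1 0 * nx w - zeta' 0 0 * ny w)))).
Proof.
have dx : is_derive p w nx (nx w).
  by apply: is_derive_linear_map; [exact: linear_row|exact: smooth_continuous (smooth_row 0)].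
have dy : is_derive p w ny (ny w).
  by apply: is_derive_linear_map; [exact: linear_row|exact: smooth_continuous (smooth_row 1)].
have dz : is_derive p w nz (nz w).
  by apply: is_derive_linear_map; [exact: linear_nz|exact: smooth_continuous smooth_nz].
have k (c : R) : is_derive p w (fun=> c) (0 : R) by exact: is_derive_cst.
have d1 := is_deriveMf (k (mu / zeta' 0 0)) dx.
have d2 := is_deriveMf (k (mu / zeta' 1 0)) dy.
have d3 := is_deriveMf (k (mu ^+ 2 / (zeta' 0 0 * zeta' 1 0)))
  (is_deriveDf (is_deriveDf dz (is_deriveMf (k 2^-1) (is_deriveMf dx dy)))
   (is_deriveMf (k (eta' 0 0 / (mu * zeta' 1 0)))
     (is_deriveDf (is_deriveMf (k (zeta' 1 0)) dx)
       (is_deriveNf (is_deriveMf (k (zeta' 0 0)) dy))))).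
have sd (f : heis R -> R) : smooth f -> differentiable f p by exact: smooth_differentiable.
have s1 : smooth (fun q => mu / zeta' 0 0 * nx q).
  by apply: smoothM; [exact: smooth_cst|exact: smooth_row].
have s2 : smooth (fun q => mu / zeta' 1 0 * ny q).
  by apply: smoothM; [exact: smooth_cst|exact: smooth_row].
rewrite normalizationE diff_pair; [|exact: sd|]; last first.
  by apply: differentiable_pair; apply: sd => //; exact: smooth_psi3.
rewrite diff_pair; [|exact: sd|exact: sd smooth_psi3].
rewrite -!deriveE; [|exact: sd smooth_psi3|exact: sd|exact: sd].
rewrite (@derive_val _ _ _ _ _ _ _ d1) (@derive_val _ _ _ _ _ _ _ d2).
rewrite (@derive_val _ _ _ _ _ _ _ d3).
by congr (_, (_, _)); ring.
Qed.

Lemma normalization_drift p : 'd Psi p (drift SH p) = drift SR3 (Psi p).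
Proof.
have [_ hN _] := nf.
have hd : drift SH p = derivation A eta p.
  rewrite /derivation /=; congr pair; rewrite omegaE dotpE !mxE /=; ring.
have [h0 h1 h2] : [/\ (P *m (drift SH p).1) 0 0 = 0,
    (P *m (drift SH p).1) 1 0 = mu * (P *m p.1) 1 0
  & dotp xi (drift SH p).1 + \det P * (drift SH p).2 =
    dotp eta' (P *m p.1) + mu * (dotp xi p.1 + \det P * p.2)].
  have [D0 D1] := scaled_delta_mulmx mu (P *m p.1).
  have := congr1 (fun X : heis R => (X.1 0 0, X.1 1 0, X.2)) (hN p).
  by rewrite hd /= D0 D1 scaled_delta_trace => -[-> -> ->].
rewrite diff_normalization normalizationE.
have -> : nx (drift SH p) = 0 by rewrite /nx /= h0 oppr0.
have -> : ny (drift SH p) = mu * ny p by rewrite /ny /= h1 mulrN.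
have -> : nz (drift SH p) = eta' 0 0 * nx p + eta' 1 0 * ny p + mu * nz p.
  by rewrite /nz h2 [dotp eta' _]dotpE /nx /ny; ring.
by rewrite /= /psi3; congr (_, (_, _)); [ring|field|field; rewrite z0_neq0 z1_neq0 tA].
Qed.

Lemma normalization_control p :
  'd Psi p (control_field SH p) = control_field SR3 (Psi p).
Proof.
have [_ _ hZ] := nf.
have [h0 h1 h2] : [/\ (P *m zeta) 0 0 = - zeta' 0 0,
    (P *m zeta) 1 0 = - zeta' 1 0 & dotp xi zeta + \det P * alpha = 0].
  have := congr1 (fun X : heis R => (X.1 0 0, X.1 1 0, X.2)) hZ.
  by move=> /= -[-> -> ->]; rewrite !mxE.
rewrite diff_normalization normalizationE.
have -> : nx (control_field SH p) = zeta' 0 0 by rewrite /nx /= h0 opprK.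
have -> : ny (control_field SH p) = zeta' 1 0 by rewrite /ny /= h1 opprK.
have -> : nz (control_field SH p) =
    2^-1 * (zeta' 0 0 * ny p - zeta' 1 0 * nx p).
  have e0 : zeta' 0 0 = - (P *m zeta) 0 0 by rewrite h0 opprK.
  have e1 : zeta' 1 0 = - (P *m zeta) 1 0 by rewrite h1 opprK.
  rewrite /nz /= mulrDr addrA h2 add0r omegaE e0 e1 /nx /ny !mulmx2E det2 !mxE.
  by ring.
by rewrite /=; congr (_, (_, _)); [field|field|field; rewrite z0_neq0 z1_neq0 tA].
Qed.

Lemma normalization_conjugation : conjugation SH SR3 Psi.
Proof.
split; [|exact: normalization_drift|exact: normalization_control].
split; first exact: smooth_normalization.
exists denormalization; split; [exact: smooth_denormalization| |].
  exact: normalizationK.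
exact: denormalizationK.
Qed.

End Normalization.

(** * The theorem *)
Theorem theorem4p5 (R : realType) (A : 'M[R]_2) (eta zeta : 'cV[R]_2)
    (alpha lo hi : R)
    (hD : derivation A eta <> (fun=> 0))
    (hZ : alpha ^+ 2 + dotp zeta zeta != 0)
    (hlo : lo < 0) (hhi : 0 < hi)
    (hLARC : LARC A eta (zeta, alpha))
    (hdet : \det A = 0) (htr : \tr A != 0) :
  (exists (P : 'M[R]_2) (xi zeta' eta' : 'cV[R]_2),
     normal_form_data A eta zeta alpha P xi zeta' eta') /\
  (forall (P : 'M[R]_2) (xi zeta' eta' : 'cV[R]_2),
     normal_form_data A eta zeta alpha P xi zeta' eta' ->
     let mu := \tr A in
     let kappa := eta' 1 0 / zeta' 0 0 in
     let Psi := normalization mu P xi zeta' eta' in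
     let SH := heis_system A eta zeta alpha in
     let SR3 := R3_system mu kappa in
     conjugation SH SR3 Psi /\
     exists2 C : set (R * R), unique (R2_control_set lo hi mu kappa) C &
       let CR3 : set (R * (R * R)) := snd @^-1` C in
       let CH : set (heis R) := Psi @^-1` CR3 in
       [/\ control_set lo hi SR3 CR3,
           forall C', control_set lo hi SR3 C' ->
             ~ degenerate mu kappa \/ interior C' !=set0 -> C' = CR3,
           control_set lo hi SH CH
         & forall C', control_set lo hi SH C' ->
             ~ degenerate mu kappa \/ interior C' !=set0 -> C' = CH]).
Proof.
split; first exact: exists_normal_form (LARC_zeta_neq0 hLARC) hdet htr.
move=> P xi zeta' eta' nf mu kappa Psi SH SR3.
have [uP hN hZ'] := nf.
have PA (v : 'cV[R]_2) : P *m (A *m v) = (mu *: delta_mx 1 1) *m (P *m v).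
  by have := congr1 fst (hN (v, 0)).
have [D0 D1] : (forall v : 'cV[R]_2, (P *m (A *m v)) 0 0 = 0) /\
    (forall v : 'cV[R]_2, (P *m (A *m v)) 1 0 = mu * (P *m v) 1 0).
  by split=> v; rewrite PA; case: (scaled_delta_mulmx mu (P *m v)).
have Pz : P *m zeta = - zeta' by have := congr1 fst hZ'.
have z0_neq0 : zeta' 0 0 != 0.
  have := LARC_coord_neq0 (i := 0) hLARC uP (fun v _ => D0 v).
  by rewrite Pz mxE oppr_eq0.
have z1_neq0 : zeta' 1 0 != 0.
  have inv (v : 'cV[R]_2) : (P *m v) 1 0 = 0 -> (P *m (A *m v)) 1 0 = 0.
    by rewrite D1 => ->; rewrite mulr0.
  by have := LARC_coord_neq0 (i := 1) hLARC uP inv; rewrite Pz mxE oppr_eq0.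
have cj : conjugation SH SR3 Psi := normalization_conjugation nf htr z0_neq0 z1_neq0.
split => //; exists (core lo hi mu kappa).
  split; first exact: core_R2_control_set.
  by move=> C' hC'; apply/esym; exact: R2_control_set_unique hC'.
have [[sPsi [h [sh PsiK hK]]] fd fc] := cj.
have dPsi p := smooth_differentiable p sPsi.
have dh q := smooth_differentiable q sh.
have mPsi := conjugation_maps_trajectories dPsi fd fc.
have mh := conjugation_inverse dPsi dh PsiK hK fd fc.
have cPsi := smooth_continuous sPsi; have ch := smooth_continuous sh.
move=> CR3 CH; split.
- exact: core3_control_set.
- by move=> C'; exact: core3_unique.
- apply: (control_set_preimage cPsi ch PsiK hK mPsi mh).
  exact: core3_control_set.
- move=> C' cC' hyp.
  have cD := control_set_preimage ch cPsi hK PsiK mh mPsi cC'.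
  have <- : Psi @^-1` (h @^-1` C') = C'.
    by apply/seteqP; split => p /=; rewrite PsiK.
  congr (Psi @^-1` _); apply: (core3_unique hlo hhi htr cD).
  case: hyp => [nd|[p np]]; [by left|right; exists (Psi p)].
  by apply: ch; rewrite PsiK.
Qed.
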